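(* Let $q=a+v\in\mathbb{H}_\mathbb{R}$ with $a>1$ and $v\ne0$, let $w:=a+i|v|\in\mathbb{C}$, and let $z\in\mathbb{C}$ with $|z|=1$. Then the complex quaternion $\sum_{\ell\in\mathbb{Z}}B_q(\ell)z^\ell$ is invertible in $\mathbb{H}_\mathbb{C}$ if and only if $$\Big(\sum_{\ell\in\mathbb{Z}}B_w(\ell)z^\ell\Big)\Big(\sum_{k\in\mathbb{Z}}B_{\overline w}(k)z^k\Big)\neq0,$$ and in that case $$\Big(\sum_{\ell}B_q(\ell)z^\ell\Big)^{-1}=\frac{\sum_\ell\big[\mathrm{Re}\,B_w(\ell)-\frac{v}{|v|}\mathrm{Im}\,B_w(\ell)\big]z^\ell}{\Big(\sum_\ell B_w(\ell)z^\ell\Big)\Big(\sum_\ell B_{\overline w}(\ell)z^\ell\Big)}.$$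
   Context: $\mathbb{H}_\mathbb{R}$ denotes the real quaternions $a+v_1e_1+v_2e_2+v_3e_3$ with $e_1^2=e_2^2=e_3^2=-1$, $e_1e_2=e_3$, $e_2e_3=e_1$, $e_3e_1=e_2$; $\mathbb{H}_\mathbb{C}$ the complex quaternions (complex coefficients, $i$ commuting with every $e_j$). For $q=a+v$, $v=\sum v_je_j$ and $|v|=(\sum v_j^2)^{1/2}$. Quaternionic power: for $\zeta\in\mathbb{C}\setminus\{0\}$, $\zeta^q:=\zeta^a[\cos(|v|\log\zeta)+\frac{v}{|v|}\sin(|v|\log\zeta)]$ (principal $\log$). Let $\Xi(\xi):=\frac{1-e^{-i\xi}}{i\xi}$, $\Xi(0):=1$. Quaternionic B-spline: $B_q(t):=\frac1{2\pi}\int_\mathbb{R}\Xi(\xi)^qe^{i\xi t}d\xi$ ($\mathrm{Sc}\,q>1$); complex B-spline: for $w\in\mathbb{C}$ with $\mathrm{Re}\,w>1$, $B_w(t):=\frac1{2\pi}\int_\mathbb{R}e^{w\log\Xi(\xi)}e^{i\xi t}d\xi$ (principal $\log$). The series $\sum_\ell B_q(\ell)z^\ell$, $\sum_\ell B_w(\ell)z^\ell$ converge absolutely. *)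

(* Defs.v *)
From Stdlib Require Import Reals Lra ZArith ClassicalEpsilon.
Open Scope R_scope.

Record Cx := mkC { Re : R; Im : R }.
Definition RtoC (r : R) : Cx := mkC r 0.
Definition C0 : Cx := RtoC 0.
Definition C1 : Cx := RtoC 1.
Definition Ci : Cx := mkC 0 1.
Definition Cadd (x y : Cx) : Cx := mkC (Re x + Re y) (Im x + Im y).
Definition Copp (x : Cx) : Cx := mkC (- Re x) (- Im x).
Definition Csub (x y : Cx) : Cx := Cadd x (Copp y).
Definition Cmul (x y : Cx) : Cx :=
  mkC (Re x * Re y - Im x * Im y) (Re x * Im y + Im x * Re y).
Definition Cnorm2 (x : Cx) : R := Re x * Re x + Im x * Im x.
Definition Cabs (x : Cx) : R := sqrt (Cnorm2 x).
Definition Cinv (x : Cx) : Cx := mkC (Re x / Cnorm2 x) (- Im x / Cnorm2 x).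
Definition Cdiv (x y : Cx) : Cx := Cmul x (Cinv y).
Definition Cconj (x : Cx) : Cx := mkC (Re x) (- Im x).
Definition Cexp (x : Cx) : Cx := mkC (exp (Re x) * cos (Im x)) (exp (Re x) * sin (Im x)).

Definition Arg (x : Cx) : R :=
  let a := Re x in let b := Im x in
  if Rlt_dec 0 a then atan (b / a)
  else if Rlt_dec a 0 then
    (if Rle_dec 0 b then atan (b / a) + PI else atan (b / a) - PI)
  else if Rlt_dec 0 b then PI / 2
  else if Rlt_dec b 0 then - (PI / 2) else 0.

Definition Clog (x : Cx) : Cx := mkC (ln (Cabs x)) (Arg x).

Definition Ccos (x : Cx) : Cx :=
  Cmul (RtoC (/ 2)) (Cadd (Cexp (Cmul Ci x)) (Cexp (Copp (Cmul Ci x)))).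
Definition Csin (x : Cx) : Cx :=
  Cdiv (Csub (Cexp (Cmul Ci x)) (Cexp (Copp (Cmul Ci x)))) (Cmul (RtoC 2) Ci).

Definition Ccpow (zeta w : Cx) : Cx :=
  if Req_EM_T (Cnorm2 zeta) 0 then C0 else Cexp (Cmul w (Clog zeta)).

Fixpoint Cpown (z : Cx) (n : nat) : Cx :=
  match n with O => C1 | S n => Cmul z (Cpown z n) end.
Definition Cpowz (z : Cx) (l : Z) : Cx :=
  match l with
  | Z0 => C1
  | Zpos p => Cpown z (Pos.to_nat p)
  | Zneg p => Cinv (Cpown z (Pos.to_nat p))
  end.

(* ---------- Complex quaternions  c0 + c1 e1 + c2 e2 + c3 e3 ---------- *)
Record HC := mkHC { h0 : Cx; h1 : Cx; h2 : Cx; h3 : Cx }.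
Definition HC1 : HC := mkHC C1 C0 C0 C0.
Definition HCmul (p q : HC) : HC :=
  mkHC
   (Csub (Csub (Csub (Cmul (h0 p) (h0 q)) (Cmul (h1 p) (h1 q))) (Cmul (h2 p) (h2 q))) (Cmul (h3 p) (h3 q)))
   (Csub (Cadd (Cadd (Cmul (h0 p) (h1 q)) (Cmul (h1 p) (h0 q))) (Cmul (h2 p) (h3 q))) (Cmul (h3 p) (h2 q)))
   (Cadd (Cadd (Csub (Cmul (h0 p) (h2 q)) (Cmul (h1 p) (h3 q))) (Cmul (h2 p) (h0 q))) (Cmul (h3 p) (h1 q)))
   (Cadd (Csub (Cadd (Cmul (h0 p) (h3 q)) (Cmul (h1 p) (h2 q))) (Cmul (h2 p) (h1 q))) (Cmul (h3 p) (h0 q))).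
Definition HCscale (c : Cx) (p : HC) : HC :=
  mkHC (Cmul c (h0 p)) (Cmul c (h1 p)) (Cmul c (h2 p)) (Cmul c (h3 p)).
Definition HCinvertible (p : HC) : Prop :=
  exists r : HC, HCmul p r = HC1 /\ HCmul r p = HC1.

(* real quaternion q = a + v1 e1 + v2 e2 + v3 e3 : |v| *)
Definition vnorm (v1 v2 v3 : R) : R := sqrt (v1 * v1 + v2 * v2 + v3 * v3).

(* quaternionic power zeta^q = zeta^a [cos(|v| log zeta) + v/|v| sin(|v| log zeta)] *)
Definition HCpowq (zeta : Cx) (a v1 v2 v3 : R) : HC :=
  let s := vnorm v1 v2 v3 in
  let za := Ccpow zeta (RtoC a) in
  let L := Cmul (RtoC s) (Clog zeta) in
  let sn := Cmul za (Csin L) in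
  mkHC (Cmul za (Ccos L))
       (Cmul (RtoC (v1 / s)) sn) (Cmul (RtoC (v2 / s)) sn) (Cmul (RtoC (v3 / s)) sn).

Definition Xi (xi : R) : Cx :=
  if Req_EM_T xi 0 then C1
  else Cdiv (Csub C1 (Cexp (Cmul (RtoC (- xi)) Ci))) (Cmul Ci (RtoC xi)).

Definition improper_int (f : R -> R) (L : R) : Prop :=
  forall eps, eps > 0 -> exists M, forall a b, a <= - M -> M <= b ->
    exists pr : Riemann_integrable f a b, Rabs (RiemannInt pr - L) < eps.
Definition Rint (f : R -> R) : R := epsilon (inhabits 0) (fun L => improper_int f L).
Definition Cint (f : R -> Cx) : Cx :=
  mkC (Rint (fun x => Re (f x))) (Rint (fun x => Im (f x))).

Definition Bq (a v1 v2 v3 : R) (t : R) : HC :=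
  let c := RtoC (/ (2 * PI)) in
  let F := fun xi => HCscale (Cexp (Cmul Ci (RtoC (xi * t)))) (HCpowq (Xi xi) a v1 v2 v3) in
  mkHC (Cmul c (Cint (fun xi => h0 (F xi)))) (Cmul c (Cint (fun xi => h1 (F xi))))
       (Cmul c (Cint (fun xi => h2 (F xi)))) (Cmul c (Cint (fun xi => h3 (F xi)))).

Definition Bw (w : Cx) (t : R) : Cx :=
  Cmul (RtoC (/ (2 * PI)))
       (Cint (fun xi => Cmul (Cexp (Cmul w (Clog (Xi xi)))) (Cexp (Cmul Ci (RtoC (xi * t)))))).

Definition sumZ_cv (f : Z -> R) (L : R) : Prop :=
  Un_cv (fun N => sum_f_R0 (fun k => f (Z.of_nat k - Z.of_nat N)%Z) (2 * N)) L.
Definition RsumZ (f : Z -> R) : R := epsilon (inhabits 0) (sumZ_cv f).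
Definition CsumZ (f : Z -> Cx) : Cx :=
  mkC (RsumZ (fun l => Re (f l))) (RsumZ (fun l => Im (f l))).
Definition HCsumZ (f : Z -> HC) : HC :=
  mkHC (CsumZ (fun l => h0 (f l))) (CsumZ (fun l => h1 (f l)))
       (CsumZ (fun l => h2 (f l))) (CsumZ (fun l => h3 (f l))).

(* Main.v *)
From Stdlib Require Import Reals ZArith Lra Lia.
From Coquelicot Require Import Rcomplements Rbar Hierarchy Continuity Derive
  RInt RInt_analysis Lim_seq Series PSeries ElemFct AutoDerive.
Require Import Defs.
Open Scope R_scope.

(** Away from the zeros of Xi, Xi^q is the quaternion with scalar part (Xi^w + Xi^w') / 2
    and vector part v/|v| (Xi^w - Xi^w') / (2i), where w' is the conjugate of w. As
    Xi(-x) is the conjugate of Xi(x), B_w' is the conjugate of B_w, hence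
    B_q = Re B_w + v/|v| Im B_w. With P = sum Re B_w(l) z^l and Q = sum Im B_w(l) z^l the
    sum of the B_q(l) z^l is P + v/|v| Q, its product with P - v/|v| Q is the scalar
    P^2 + Q^2, and this is (P + iQ)(P - iQ), the product of the sums for w and w'.

    The analytic point is the convergence of P and Q. Let f be the real or imaginary part of
    Xi^w. Since Xi(x) = sinc(x/2) exp(-ix/2), f'' is bounded by a multiple of
    |sinc(x/2)|^(a-2) / (1+|x|)^2 off the zeros of Xi, whence
    |f(x+h) - 2 f(x) + f(x-h)| <= C h^b / (1+|x|)^b with b = min(a,2) > 1. Taking
    h = pi/|l|, the integral of f(x) exp(ilx) is -1/4 times that of the second difference,
    so that B_w(l) = O(|l|^(-b)). *)

(** * The function sinc (x / 2) *)

(** Two obstacles shape the proof. One is the zero set of Xi, the nonzero multiples of 2 PI. At each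
    of them the argument of Xi jumps by PI, and f'' may be unbounded nearby when a < 2; a second
    difference steps over a zero and keeps every integrand continuous, at the price of the exponent
    b. Elsewhere Xi never meets the negative real axis, so its principal logarithm is smooth between
    consecutive zeros. The other is that the definitions are total. [Rint] and [RsumZ] select a
    limit by [epsilon], so an identity between integrals or sums means nothing before convergence is
    proved. At a zero of Xi the integrand of [Bq] is 0 while that of [Bw] has modulus 1; integrands
    are therefore compared only off the zeros, which the Riemann integral does not see. The
    inequality b > 1 serves twice: it makes f integrable at infinity, and it makes the coefficients
    summable over l. *)

Lemma sin_PSeries (x : R) : sin x = x * PSeries sin_n (x * x).
Proof.
unfold sin; destruct (exist_sin x²) as [l Hl].
apply Rmult_eq_compat_l, eq_sym, is_pseries_unique, is_pseries_Reals, Hl.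
Qed.

(** The series converges at every point, so its terms tend to 0 everywhere; with a finite radius r
    they could not do so at [Rabs r + 1]. *)
Lemma CV_radius_sin_n : CV_radius sin_n = p_infty.
Proof.
destruct (CV_radius sin_n) as [r| |] eqn:E; [|reflexivity|].
- exfalso. pose (x := Rabs r + 1).
  assert (Hx : Rbar_lt (CV_radius sin_n) (Rabs x)).
  { rewrite E; simpl; unfold x. pose proof (Rle_abs r). pose proof (Rabs_pos r).
    rewrite (Rabs_pos_eq (Rabs r + 1)); lra. }
  apply (CV_disk_outside _ _ Hx), ex_series_lim_0.
  destruct (exist_sin x) as [l Hl]. exists l. apply is_series_Reals, Hl.
- exfalso. pose proof (CV_radius_ge_0 sin_n) as H. rewrite E in H. exact H.
Qed.

(** This is sin (x/2) / (x/2), not a hyperbolic function. The power series in (x/2)^2 makes it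
    smooth at 0 without a case distinction. *)
Definition sinch (x : R) : R := PSeries sin_n (x * x / 4).

Definition sinch' (x : R) : R := x / 2 * PSeries (PS_derive sin_n) (x * x / 4).

Definition sinch'' (x : R) : R :=
  PSeries (PS_derive sin_n) (x * x / 4) / 2
  + x * x / 4 * PSeries (PS_derive (PS_derive sin_n)) (x * x / 4).

Lemma sinch_mul (x : R) : x * sinch x = 2 * sin (x / 2).
Proof.
rewrite (sin_PSeries (x / 2)). unfold sinch.
replace (x / 2 * (x / 2)) with (x * x / 4) by field. field.
Qed.

Lemma sinch_neq0 (x : R) : x <> 0 -> sinch x = sin (x / 2) / (x / 2).
Proof.
intros Hx. apply (Rmult_eq_reg_l x); [|exact Hx].
rewrite sinch_mul. field. exact Hx.
Qed.

Lemma sinch_0 : sinch 0 = 1.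
Proof.
unfold sinch. replace (0 * 0 / 4) with 0 by field.
rewrite PSeries_0. unfold sin_n; simpl; field.
Qed.

Lemma sinch_opp (x : R) : sinch (- x) = sinch x.
Proof. unfold sinch. f_equal. field. Qed.

Lemma is_derive_sinch (x : R) : is_derive sinch x (sinch' x).
Proof.
unfold sinch, sinch'.
evar_last.
- apply (is_derive_comp (PSeries sin_n) (fun x => x * x / 4)).
  + apply is_derive_PSeries. rewrite CV_radius_sin_n. exact I.
  + auto_derive; [exact I|reflexivity].
- unfold scal; simpl; unfold mult; simpl. field.
Qed.

Lemma is_derive_sinch' (x : R) : is_derive sinch' x (sinch'' x).
Proof.
unfold sinch', sinch''.
evar_last.
- apply (is_derive_mult (fun x => x / 2) (fun x => PSeries (PS_derive sin_n) (x * x / 4))).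
  + auto_derive; [exact I|reflexivity].
  + apply (is_derive_comp (PSeries (PS_derive sin_n)) (fun x => x * x / 4)).
    * apply is_derive_PSeries. rewrite CV_radius_derive, CV_radius_sin_n. exact I.
    * auto_derive; [exact I|reflexivity].
  + intros; apply Rmult_comm.
- unfold plus, scal, mult; simpl; unfold mult; simpl. field.
Qed.

Lemma continuous_sinch'' (x : R) : continuous sinch'' x.
Proof.
apply (ex_derive_continuous sinch''). unfold sinch''.
assert (H : forall a, CV_radius a = p_infty ->
  ex_derive (fun x => PSeries a (x * x / 4)) x).
{ intros a Ha. apply (ex_derive_comp (PSeries a) (fun x => x * x / 4)).
  - eexists. apply is_derive_PSeries. rewrite Ha. exact I.
  - auto_derive; exact I. }
apply (ex_derive_plus (fun x => PSeries (PS_derive sin_n) (x * x / 4) / 2)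
  (fun x => x * x / 4 * PSeries (PS_derive (PS_derive sin_n)) (x * x / 4))).
- apply (ex_derive_mult (fun x => PSeries (PS_derive sin_n) (x * x / 4)) (fun _ => / 2)).
  + apply H. rewrite CV_radius_derive. apply CV_radius_sin_n.
  + apply ex_derive_const.
- apply (ex_derive_mult (fun x => x * x / 4)
    (fun x => PSeries (PS_derive (PS_derive sin_n)) (x * x / 4))).
  + auto_derive; exact I.
  + apply H. rewrite !CV_radius_derive. apply CV_radius_sin_n.
Qed.

(** Differentiating [sinch_mul] once, and then a second time in [sinch''_mul], expresses x sinch'
    and x sinch'' through bounded functions. This is the source of the decay 1 / (1 + |x|). *)
Lemma sinch'_mul (x : R) : sinch x + x * sinch' x = cos (x / 2).
Proof.
assert (H1 : is_derive (fun x => x * sinch x) x (sinch x + x * sinch' x)).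
{ evar_last.
  - apply (is_derive_mult (fun x => x) sinch).
    + apply (is_derive_id (K := R_AbsRing)).
    + apply is_derive_sinch.
    + intros; apply Rmult_comm.
  - unfold plus, mult, one; simpl. ring. }
assert (H2 : is_derive (fun x => x * sinch x) x (cos (x / 2))).
{ apply (is_derive_ext (fun x => 2 * sin (x / 2))).
  - intros t. symmetry. apply sinch_mul.
  - auto_derive; [exact I|unfold Rdiv; field]. }
apply is_derive_unique in H1. apply is_derive_unique in H2. congruence.
Qed.

Lemma sinch''_mul (x : R) : 2 * sinch' x + x * sinch'' x = - sin (x / 2) / 2.
Proof.
assert (H1 : is_derive (fun x => sinch x + x * sinch' x) x (2 * sinch' x + x * sinch'' x)).
{ evar_last.
  - apply (is_derive_plus sinch (fun x => x * sinch' x)).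
    + apply is_derive_sinch.
    + apply (is_derive_mult (fun x => x) sinch').
      * apply (is_derive_id (K := R_AbsRing)).
      * apply is_derive_sinch'.
      * intros; apply Rmult_comm.
  - unfold plus, mult, one; simpl. ring. }
assert (H2 : is_derive (fun x => sinch x + x * sinch' x) x (- sin (x / 2) / 2)).
{ apply (is_derive_ext (fun x => cos (x / 2))).
  - intros t. symmetry. apply sinch'_mul.
  - auto_derive; [exact I|unfold Rdiv; field]. }
apply is_derive_unique in H1. apply is_derive_unique in H2. congruence.
Qed.

Lemma inv_bound (g : R -> R) (c : R) :
  (forall x, continuous g x) -> (forall x, 1 <= Rabs x -> Rabs x * Rabs (g x) <= c) ->
  exists K, forall x, Rabs (g x) <= K / (1 + Rabs x).
Proof.
intros Hg Hc.
destruct (bounded_continuity g (-1) 1) as [M HM]; [intros; apply Hg|].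
(* The factors 2 come from 1 + |x| <= 2 on [-1, 1] and from 1 + |x| <= 2 |x| outside. *)
exists (Rmax (2 * M) (2 * c)). intros x.
assert (Hp := Rabs_pos x). assert (Hq := Rabs_pos (g x)).
apply Rle_div_r; [lra|].
destruct (Rle_lt_dec 1 (Rabs x)) as [H|H].
- apply Rle_trans with (2 * c); [|apply Rmax_r].
  specialize (Hc x H). nra.
- apply Rle_trans with (2 * M); [|apply Rmax_l].
  assert (H' : -1 <= x <= 1) by (apply Rabs_def2 in H; lra).
  specialize (HM x H'). change (norm (g x)) with (Rabs (g x)) in HM. nra.
Qed.

Lemma sinch_bounds : exists K, 1 <= K /\ forall x,
  Rabs (sinch x) <= K / (1 + Rabs x) /\ Rabs (sinch' x) <= K / (1 + Rabs x) /\
  Rabs (sinch'' x) <= K / (1 + Rabs x).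
Proof.
assert (Hs : forall y, Rabs (sin y) <= 1) by (intros; apply Rabs_le, SIN_bound).
assert (Hc : forall y, Rabs (cos y) <= 1) by (intros; apply Rabs_le, COS_bound).
(* The three constants are 2 from |2 sin|, then 3 = 1 + 2 from cos and [sinch], then 7 >= 1/2 + 2 *
   3; |x| >= 1 is used to bound a function by |x| times it. *)
assert (B0 : forall x, 1 <= Rabs x -> Rabs x * Rabs (sinch x) <= 2).
{ intros x Hx. rewrite <- Rabs_mult, sinch_mul, Rabs_mult, (Rabs_pos_eq 2) by lra.
  specialize (Hs (x / 2)). lra. }
assert (B1 : forall x, 1 <= Rabs x -> Rabs x * Rabs (sinch' x) <= 3).
{ intros x Hx. rewrite <- Rabs_mult.
  replace (x * sinch' x) with (cos (x / 2) - sinch x) by (rewrite <- sinch'_mul; ring).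
  unfold Rminus. eapply Rle_trans; [apply Rabs_triang|]. rewrite Rabs_Ropp.
  specialize (B0 x Hx). specialize (Hc (x / 2)). pose proof (Rabs_pos (sinch x)). nra. }
assert (B2 : forall x, 1 <= Rabs x -> Rabs x * Rabs (sinch'' x) <= 7).
{ intros x Hx. rewrite <- Rabs_mult.
  replace (x * sinch'' x) with (- sin (x / 2) / 2 + - (2 * sinch' x))
    by (rewrite <- sinch''_mul; ring).
  eapply Rle_trans; [apply Rabs_triang|]. rewrite Rabs_Ropp, (Rabs_mult 2), (Rabs_pos_eq 2) by lra.
  unfold Rdiv. rewrite Rabs_mult, Rabs_Ropp, (Rabs_pos_eq (/ 2)) by lra.
  specialize (B1 x Hx). specialize (Hs (x / 2)). pose proof (Rabs_pos (sinch' x)).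
  change (x * / 2) with (x / 2). nra. }
destruct (inv_bound sinch 2) as [K0 H0]; [|exact B0|].
{ intros x. apply (ex_derive_continuous sinch). eexists. apply is_derive_sinch. }
destruct (inv_bound sinch' 3) as [K1 H1]; [|exact B1|].
{ intros x. apply (ex_derive_continuous sinch'). eexists. apply is_derive_sinch'. }
destruct (inv_bound sinch'' 7) as [K2 H2]; [apply continuous_sinch''|exact B2|].
exists (Rmax 1 (Rmax K0 (Rmax K1 K2))). split; [apply Rmax_l|]. intros x.
assert (Hp := Rabs_pos x).
assert (Hm : forall k, k <= Rmax 1 (Rmax K0 (Rmax K1 K2)) ->
  k / (1 + Rabs x) <= Rmax 1 (Rmax K0 (Rmax K1 K2)) / (1 + Rabs x)).
{ intros k Hk. apply Rmult_le_compat_r; [left; apply Rinv_0_lt_compat; lra|exact Hk]. }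
repeat split; (eapply Rle_trans; [eauto|]); apply Hm; unfold Rmax; repeat destruct Rle_dec; lra.
Qed.

(** * Modulus and argument of Xi *)

Lemma Xi_sinch (x : R) : Xi x = mkC (sinch x * cos (x / 2)) (- (sinch x * sin (x / 2))).
Proof.
unfold Xi. destruct (Req_EM_T x 0) as [->|Hx].
- rewrite sinch_0. replace (0 / 2) with 0 by field. rewrite cos_0, sin_0.
  unfold C1, RtoC. f_equal; ring.
- assert (Hs : sin (- x) = - (2 * sin (x / 2) * cos (x / 2))).
  { rewrite sin_neg, <- sin_2a. f_equal. f_equal. field. }
  assert (Hc : cos (- x) = 1 - 2 * sin (x / 2) * sin (x / 2)).
  { rewrite cos_neg, <- cos_2a_sin. f_equal. field. }
  rewrite (sinch_neq0 x Hx).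
  unfold Cdiv, Cinv, Cmul, Csub, Cadd, Copp, Cexp, Ci, RtoC, C1, Cnorm2, RtoC; simpl.
  replace (- x * 0 - 0 * 1) with 0 by ring. replace (- x * 1 + 0 * 0) with (- x) by ring.
  rewrite exp_0, Hs, Hc. f_equal; field; nra.
Qed.

Lemma Cabs_Xi (x : R) : Cabs (Xi x) = Rabs (sinch x).
Proof.
unfold Cabs, Cnorm2. rewrite Xi_sinch; simpl. rewrite <- sqrt_Rsqr_abs. f_equal. unfold Rsqr.
pose proof (sin2_cos2 (x / 2)) as H. unfold Rsqr in H.
transitivity (sinch x * sinch x * (sin (x / 2) * sin (x / 2) + cos (x / 2) * cos (x / 2))); [ring|].
rewrite H. ring.
Qed.

(** [Arg] is defined by branches in Re u that meet on the imaginary axis. Below the real axis this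
    single formula covers them all and can be differentiated; [Arg_Im_pos] does the same above
    it. *)
Lemma Arg_Im_neg (u : Cx) : Im u < 0 -> Arg u = - (PI / 2) - atan (Re u / Im u).
Proof.
destruct u as [p q]; simpl; intros Hq. unfold Arg; simpl.
destruct (Rlt_dec 0 p) as [Hp|Hp].
- replace (p / q) with (- / (- (q / p))) by (field; lra).
  assert (0 < - (q / p)).
  { replace (- (q / p)) with ((- q) / p) by (field; lra). apply Rdiv_lt_0_compat; lra. }
  rewrite atan_opp, atan_inv, atan_opp by assumption. ring.
- destruct (Rlt_dec p 0) as [Hp'|Hp'].
  + destruct (Rle_dec 0 q); [lra|].
    replace (p / q) with (/ (q / p)) by (field; lra).
    assert (0 < q / p).
    { replace (q / p) with ((- q) / (- p)) by (field; lra). apply Rdiv_lt_0_compat; lra. }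
    rewrite atan_inv by assumption. lra.
  + assert (p = 0) by lra; subst. destruct (Rlt_dec 0 q); [lra|]. destruct (Rlt_dec q 0); [|lra].
    unfold Rdiv at 3. rewrite Rmult_0_l, atan_0. ring.
Qed.

(** The only exception is the negative real axis, where u and its conjugate both have argument
    PI. *)
Lemma Arg_conj (u : Cx) : Im u <> 0 \/ 0 <= Re u -> Arg (Cconj u) = - Arg u.
Proof.
destruct u as [p q]; simpl; intros H. unfold Arg, Cconj; simpl.
destruct (Rlt_dec 0 p).
- unfold Rdiv. rewrite Ropp_mult_distr_l_reverse. apply atan_opp.
- unfold Rdiv. rewrite Ropp_mult_distr_l_reverse, atan_opp.
  repeat (destruct Rlt_dec || destruct Rle_dec); lra.
Qed.

Lemma Arg_Im_pos (u : Cx) : 0 < Im u -> Arg u = PI / 2 - atan (Re u / Im u).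
Proof.
intros H. destruct u as [p q]; simpl in *.
pose proof (Arg_conj (mkC p q)) as E. unfold Cconj in E; simpl in E.
rewrite Arg_Im_neg in E by (simpl; lra). simpl in E.
replace (p / - q) with (- (p / q)) in E by (field; lra). rewrite atan_opp in E.
assert (q <> 0 \/ 0 <= p) by (left; lra). specialize (E H0). lra.
Qed.

Lemma Arg_bound (u : Cx) : Rabs (Arg u) <= PI.
Proof.
unfold Arg. pose proof PI_RGT_0. pose proof (atan_bound (Im u / Re u)).
destruct (Rlt_dec 0 (Re u)) as [h|h]; [apply Rabs_le; lra|].
destruct (Rlt_dec (Re u) 0) as [h'|h'].
- assert (E : Im u / Re u = - (Im u * / (- Re u))) by (field; lra).
  assert (P : 0 < / (- Re u)) by (apply Rinv_0_lt_compat; lra).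
  destruct (Rle_dec 0 (Im u)) as [k|k].
  + assert (atan (Im u / Re u) <= 0).
    { rewrite <- atan_0. destruct (Req_dec (Im u) 0) as [z|z].
      - rewrite z. right. f_equal. field. lra.
      - left. apply atan_increasing. rewrite E. nra. }
    apply Rabs_le; lra.
  + assert (0 < atan (Im u / Re u)).
    { rewrite <- atan_0. apply atan_increasing. rewrite E. nra. }
    apply Rabs_le; lra.
- repeat destruct Rlt_dec; apply Rabs_le; lra.
Qed.

Definition ArgXi (x : R) : R := Arg (Xi x).

(** Off its zeros Xi is real only at x = 0, where it is 1. Hence Xi avoids the cut of the principal
    logarithm. *)
Lemma sin_half_eq0 (x : R) : sinch x <> 0 -> sin (x / 2) = 0 -> x = 0.
Proof.
intros H H0. pose proof (sinch_mul x) as E. rewrite H0, Rmult_0_r in E.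
apply Rmult_integral in E. tauto.
Qed.

Lemma ArgXi_opp (x : R) : ArgXi (- x) = - ArgXi x.
Proof.
unfold ArgXi. rewrite <- Arg_conj.
- f_equal. rewrite !Xi_sinch, sinch_opp. unfold Cconj; simpl.
  replace (- x / 2) with (- (x / 2)) by field. rewrite cos_neg, sin_neg. f_equal; ring.
- rewrite Xi_sinch; simpl.
  destruct (Req_dec (sinch x) 0) as [E|E]; [right; rewrite E; lra|].
  destruct (Req_dec (sin (x / 2)) 0) as [F|F].
  + right. rewrite (sin_half_eq0 x E F), sinch_0. replace (0 / 2) with 0 by field.
    rewrite cos_0. lra.
  + left. nra.
Qed.

Lemma continuous_locally_gt (f : R -> R) (x c : R) :
  continuous f x -> c < f x -> locally x (fun y => c < f y).
Proof. intros Hf Hc. apply Hf. apply (open_gt c). exact Hc. Qed.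

Lemma continuous_sinch (x : R) : continuous sinch x.
Proof. apply (ex_derive_continuous sinch). eexists. apply is_derive_sinch. Qed.

(** Up to a locally constant multiple of PI the argument of Xi is - x / 2. The proof uses three
    local formulas, for Im Xi positive, zero and negative; the real factor [sinch] cancels from each
    quotient. *)
Lemma is_derive_ArgXi (x : R) : sinch x <> 0 -> is_derive ArgXi x (- / 2).
Proof.
intros Hx.
assert (Ci1 : continuous (fun y => sinch y * sin (y / 2)) x).
{ apply (continuous_mult sinch (fun y => sin (y / 2))); [apply continuous_sinch|].
  apply (ex_derive_continuous (fun y => sin (y / 2))). auto_derive. exact I. }
assert (Ci2 : continuous (fun y => - (sinch y * sin (y / 2))) x).
{ apply (continuous_opp (fun y => sinch y * sin (y / 2))). exact Ci1. }
assert (D : forall c, sin (x / 2) <> 0 ->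
  is_derive (fun y => c - atan (- (cos (y / 2) / sin (y / 2)))) x (- / 2)).
{ intros c Hs. auto_derive; [exact Hs|].
  pose proof (sin2_cos2 (x / 2)) as H. unfold Rsqr in *. unfold Rdiv in *.
  assert (sin (x * / 2) * sin (x * / 2) + cos (x * / 2) * cos (x * / 2) <> 0) by lra.
  (* The identity is rational in sin and cos: their sum of squares arises from the derivative of
     atan and cancels, and only its being nonzero is required. *)
  apply (Rmult_eq_reg_r (2 * (sin (x * / 2) * sin (x * / 2) + cos (x * / 2) * cos (x * / 2)))); [|lra].
  transitivity (- (sin (x * / 2) * sin (x * / 2) + cos (x * / 2) * cos (x * / 2))); [|field].
  field. split; [exact Hs|lra]. }
assert (Q : forall y, sinch y * sin (y / 2) <> 0 ->
  sinch y * cos (y / 2) / - (sinch y * sin (y / 2)) = - (cos (y / 2) / sin (y / 2))).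
{ intros y Hy. field. split; intros E; apply Hy; rewrite E; ring. }
destruct (Rtotal_order (sinch x * sin (x / 2)) 0) as [H|[H|H]].
- apply (is_derive_ext_loc (fun y => PI / 2 - atan (- (cos (y / 2) / sin (y / 2))))).
  + assert (H' : 0 < - (sinch x * sin (x / 2))) by lra.
    apply (filter_imp (fun y => 0 < - (sinch y * sin (y / 2)))).
    * intros y Hy. unfold ArgXi. rewrite Xi_sinch, Arg_Im_pos by (simpl; exact Hy).
      simpl. rewrite Q by lra. reflexivity.
    * apply continuous_locally_gt; assumption.
  + apply D. intros E. rewrite E in H. lra.
- assert (x = 0).
  { apply sin_half_eq0; [exact Hx|]. apply Rmult_integral in H. tauto. }
  subst x.
  apply (is_derive_ext_loc (fun y => - atan (sin (y / 2) / cos (y / 2)))).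
  + apply (filter_imp (fun y => 0 < sinch y * cos (y / 2))).
    * intros y Hy. unfold ArgXi. rewrite Xi_sinch. unfold Arg; simpl.
      destruct (Rlt_dec 0 (sinch y * cos (y / 2))) as [h|h]; [|contradiction].
      rewrite <- atan_opp. f_equal. field. split; intros E; rewrite E in h; lra.
    * apply (continuous_locally_gt (fun y => sinch y * cos (y / 2))).
      -- apply (continuous_mult sinch (fun y => cos (y / 2))); [apply continuous_sinch|].
         apply (ex_derive_continuous (fun y => cos (y / 2))). auto_derive. exact I.
      -- rewrite sinch_0. replace (0 / 2) with 0 by field. rewrite cos_0. lra.
  + assert (E : 0 * / 2 = 0) by ring.
    auto_derive; unfold Rdiv; rewrite ?E, ?cos_0, ?sin_0; [lra|]. unfold Rsqr. field.
- apply (is_derive_ext_loc (fun y => - (PI / 2) - atan (- (cos (y / 2) / sin (y / 2))))).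
  + apply (filter_imp (fun y => 0 < sinch y * sin (y / 2))).
    * intros y Hy. unfold ArgXi. rewrite Xi_sinch, Arg_Im_neg by (simpl; lra).
      simpl. rewrite Q by lra. reflexivity.
    * apply (continuous_locally_gt (fun y => sinch y * sin (y / 2))); assumption.
  + apply D. intros E. rewrite E in H. lra.
Qed.

(** * The modulus and phase of powers of Xi *)

Lemma exp_le (x y : R) : x <= y -> exp x <= exp y.
Proof. intros [H| ->]; [left; apply exp_increasing, H|right; reflexivity]. Qed.

Definition logmod (x : R) : R := ln (Rabs (sinch x)).

Lemma is_derive_logmod (x : R) : sinch x <> 0 ->
  is_derive logmod x (sinch' x / sinch x).
Proof.
intros Hx. assert (D := is_derive_sinch x).
assert (E : ex_derive sinch x) by (eexists; exact D). apply is_derive_unique in D.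
destruct (Rtotal_order (sinch x) 0) as [H|[H|H]]; [|contradiction|].
- apply (is_derive_ext_loc (fun y => ln (- sinch y))).
  + apply (filter_imp (fun y => 0 < - sinch y)).
    * intros y Hy. unfold logmod. rewrite Rabs_left by lra. reflexivity.
    * apply (continuous_locally_gt (fun y => - sinch y)); [|lra].
      apply (continuous_opp sinch), continuous_sinch.
  + auto_derive; [split; [exact E|split; [lra|exact I]]|].
    replace (Derive (fun x => sinch x) x) with (sinch' x) by (symmetry; exact D).
    field; lra.
- apply (is_derive_ext_loc (fun y => ln (sinch y))).
  + apply (filter_imp (fun y => 0 < sinch y)).
    * intros y Hy. unfold logmod. rewrite Rabs_pos_eq by lra. reflexivity.
    * apply (continuous_locally_gt sinch); [apply continuous_sinch|lra].
  + auto_derive; [split; [exact E|split; [lra|exact I]]|].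
    replace (Derive (fun x => sinch x) x) with (sinch' x) by (symmetry; exact D).
    field; lra.
Qed.

Lemma is_derive_logmod' (x : R) : sinch x <> 0 ->
  is_derive (fun y => sinch' y / sinch y) x
    (sinch'' x / sinch x - (sinch' x / sinch x) * (sinch' x / sinch x)).
Proof.
intros Hx. assert (D := is_derive_sinch x). assert (D' := is_derive_sinch' x).
assert (E : ex_derive sinch x) by (eexists; exact D). apply is_derive_unique in D.
assert (E' : ex_derive sinch' x) by (eexists; exact D'). apply is_derive_unique in D'.
auto_derive; [tauto|].
replace (Derive (fun x => sinch x) x) with (sinch' x) by (symmetry; exact D).
replace (Derive (fun x => sinch' x) x) with (sinch'' x) by (symmetry; exact D').
field; exact Hx.
Qed.

(** The real part of exp (p + i (r + phi)). The values phi = 0 and phi = - PI / 2 give the real and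
    imaginary parts of exp (p + i r), so both are treated at once. *)
Definition polar (p r : R -> R) (phi x : R) : R := exp (p x) * cos (r x + phi).

Definition polar' (p r p1 r1 : R -> R) (phi x : R) : R :=
  exp (p x) * (p1 x * cos (r x + phi) - r1 x * sin (r x + phi)).

(** The two coefficients are the real and imaginary parts of (p2 + i r2) + (p1 + i r1)^2, the factor
    produced by differentiating an exponential twice. *)
Definition polar'' (p r p1 r1 : R -> R) (p2 r2 phi x : R) : R :=
  exp (p x) * ((p2 + p1 x * p1 x - r1 x * r1 x) * cos (r x + phi)
               - (r2 + 2 * p1 x * r1 x) * sin (r x + phi)).

Lemma is_derive_polar (p r : R -> R) (p1 r1 phi x : R) :
  is_derive p x p1 -> is_derive r x r1 ->
  is_derive (polar p r phi) x (polar' p r (fun _ => p1) (fun _ => r1) phi x).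
Proof.
intros Dp Dr. unfold polar, polar'.
assert (Ep : ex_derive p x) by (eexists; exact Dp). apply is_derive_unique in Dp.
assert (Er : ex_derive r x) by (eexists; exact Dr). apply is_derive_unique in Dr.
auto_derive; [tauto|].
replace (Derive (fun x => p x) x) with p1 by (symmetry; exact Dp).
replace (Derive (fun x => r x) x) with r1 by (symmetry; exact Dr). ring.
Qed.

Lemma is_derive_polar' (p r p1 r1 : R -> R) (p2 r2 phi x : R) :
  is_derive p x (p1 x) -> is_derive r x (r1 x) ->
  is_derive p1 x p2 -> is_derive r1 x r2 ->
  is_derive (polar' p r p1 r1 phi) x (polar'' p r p1 r1 p2 r2 phi x).
Proof.
intros Dp Dr Dp1 Dr1. unfold polar', polar''.
assert (Ep : ex_derive p x) by (eexists; exact Dp). apply is_derive_unique in Dp.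
assert (Er : ex_derive r x) by (eexists; exact Dr). apply is_derive_unique in Dr.
assert (Ep1 : ex_derive p1 x) by (eexists; exact Dp1). apply is_derive_unique in Dp1.
assert (Er1 : ex_derive r1 x) by (eexists; exact Dr1). apply is_derive_unique in Dr1.
auto_derive; [tauto|].
replace (Derive (fun x => p x) x) with (p1 x) by (symmetry; exact Dp).
replace (Derive (fun x => r x) x) with (r1 x) by (symmetry; exact Dr).
replace (Derive (fun x => p1 x) x) with p2 by (symmetry; exact Dp1).
replace (Derive (fun x => r1 x) x) with r2 by (symmetry; exact Dr1). ring.
Qed.

Lemma Rabs_trig_le (u v t : R) : Rabs (u * cos t - v * sin t) <= Rabs u + Rabs v.
Proof.
unfold Rminus. eapply Rle_trans; [apply Rabs_triang|]. rewrite Rabs_Ropp, !Rabs_mult.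
assert (Rabs (cos t) <= 1) by (apply Rabs_le, COS_bound).
assert (Rabs (sin t) <= 1) by (apply Rabs_le, SIN_bound).
pose proof (Rabs_pos u). pose proof (Rabs_pos v). nra.
Qed.

Lemma MVT_abs (f df : R -> R) (x y B : R) :
  (forall t, Rmin x y <= t <= Rmax x y -> is_derive f t (df t)) ->
  (forall t, Rmin x y <= t <= Rmax x y -> Rabs (df t) <= B) ->
  Rabs (f y - f x) <= B * Rabs (y - x).
Proof.
intros Hd Hb. destruct (MVT_gen f x y df) as [c [Hc E]].
- intros t Ht. apply Hd. lra.
- intros t Ht. apply continuity_pt_filterlim.
  apply (ex_derive_continuous f). eexists. apply Hd, Ht.
- rewrite E, Rabs_mult. apply Rmult_le_compat_r; [apply Rabs_pos|apply Hb, Hc].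
Qed.

(** The second difference is g h - g 0 for g u = f (x + u) + f (x - u). The mean value theorem for
    [df] bounds g' by 2 h B, and a second use of it bounds the increment of g. *)
Lemma second_difference (f df ddf : R -> R) (x h B : R) : 0 < h ->
  (forall t, x - h <= t <= x + h -> is_derive f t (df t)) ->
  (forall t, x - h <= t <= x + h -> is_derive df t (ddf t)) ->
  (forall t, x - h <= t <= x + h -> Rabs (ddf t) <= B) ->
  Rabs (f (x + h) - 2 * f x + f (x - h)) <= 2 * B * (h * h).
Proof.
intros h0 H1 H2 H3.
set (g := fun u => f (x + u) + f (x - u)).
assert (Hg : Rabs (g h - g 0) <= (2 * h * B) * Rabs (h - 0)).
{ apply (MVT_abs g (fun u => df (x + u) - df (x - u))).
  - rewrite Rmin_left, Rmax_right by lra. intros t Ht. evar_last.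
    + apply (is_derive_plus (fun u => f (x + u)) (fun u => f (x - u))).
      * apply (is_derive_comp f (fun u => x + u)); [apply H1; lra|].
        auto_derive; [exact I|reflexivity].
      * apply (is_derive_comp f (fun u => x - u)); [apply H1; lra|].
        auto_derive; [exact I|reflexivity].
    + unfold plus, scal, mult; simpl; unfold mult; simpl. ring.
  - rewrite Rmin_left, Rmax_right by lra. intros t Ht.
    assert (Q : Rabs (df (x + t) - df (x - t)) <= B * Rabs ((x + t) - (x - t))).
    { apply (MVT_abs df ddf); rewrite Rmin_left, Rmax_right by lra; intros u Hu;
        [apply H2|apply H3]; lra. }
    assert (B0 : 0 <= B).
    { apply Rle_trans with (Rabs (ddf x)); [apply Rabs_pos|apply H3; lra]. }
    replace ((x + t) - (x - t)) with (2 * t) in Q by ring.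
    rewrite (Rabs_pos_eq (2 * t)) in Q by lra. nra. }
unfold g in Hg. rewrite !Rminus_0_r, Rplus_0_r, (Rabs_pos_eq h) in Hg by lra.
replace (f (x + h) - 2 * f x + f (x - h)) with (f (x + h) + f (x - h) - (f x + f x)) by ring.
lra.
Qed.

(** Both sides are values of t ^ (c - 2), nonincreasing for c <= 2. This is the reason for capping
    the exponent b at 2. *)
Lemma Rpower_div_sqr_anti (c S T : R) : c <= 2 -> 0 < T <= S ->
  Rpower S c / (S * S) <= Rpower T c / (T * T).
Proof.
intros Hc HT.
assert (E : forall t, 0 < t -> Rpower t c / (t * t) = exp ((c - 2) * ln t)).
{ intros t Ht. replace ((c - 2) * ln t) with (c * ln t + - (ln t + ln t)) by ring.
  rewrite exp_plus, exp_Ropp, exp_plus, exp_ln by exact Ht. reflexivity. }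
rewrite !E by lra. apply exp_le.
assert (ln T <= ln S) by (apply ln_le; lra). nra.
Qed.

(** * Size and regularity of the powers of Xi *)

Definition modexp (a s x : R) : R := a * logmod x - s * ArgXi x.

(** [modexp] and [phase] are the real and imaginary parts of (a + i s) log Xi. *)
Definition phase (a s x : R) : R := s * logmod x + a * ArgXi x.

(* Re (exp (i phi) * Xi x ^ (a + i s)), with the value 0 at the zeros of Xi so that it
   is continuous; there [Cexp (Cmul w (Clog (Xi x)))] has the junk value exp 0 = 1. *)
Definition amp (a s phi x : R) : R :=
  if Req_EM_T (sinch x) 0 then 0 else polar (modexp a s) (phase a s) phi x.

Section Amp.

Variables a s phi : R.
Hypothesis a1 : 1 < a.

(** The derivatives of [modexp] and [phase]; the constants s / 2 and - a / 2 come from the slope -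
    1/2 of [ArgXi]. *)
Let p1 (x : R) : R := a * (sinch' x / sinch x) + s / 2.
Let r1 (x : R) : R := s * (sinch' x / sinch x) - a / 2.
Let mu' (x : R) : R :=
  sinch'' x / sinch x - (sinch' x / sinch x) * (sinch' x / sinch x).
Let amp' (x : R) : R := polar' (modexp a s) (phase a s) p1 r1 phi x.
Let amp'' (x : R) : R :=
  polar'' (modexp a s) (phase a s) p1 r1 (a * mu' x) (s * mu' x) phi x.

Lemma is_derive_modexp (x : R) : sinch x <> 0 -> is_derive (modexp a s) x (p1 x).
Proof.
intros H. evar_last.
- apply (is_derive_minus (fun x => a * logmod x) (fun x => s * ArgXi x)).
  + apply is_derive_scal, is_derive_logmod, H.
  + apply is_derive_scal, is_derive_ArgXi, H.
- unfold minus, plus, opp, scal, mult, p1; simpl; unfold mult; simpl. field. exact H.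
Qed.

Lemma is_derive_phase (x : R) : sinch x <> 0 -> is_derive (phase a s) x (r1 x).
Proof.
intros H. evar_last.
- apply (is_derive_plus (fun x => s * logmod x) (fun x => a * ArgXi x)).
  + apply is_derive_scal, is_derive_logmod, H.
  + apply is_derive_scal, is_derive_ArgXi, H.
- unfold plus, opp, scal, mult, r1; simpl; unfold mult; simpl. field. exact H.
Qed.

Lemma locally_sinch_neq0 (x : R) : sinch x <> 0 -> locally x (fun y => sinch y <> 0).
Proof.
intros H. apply (filter_imp (fun y => 0 < sinch y * sinch y)).
- intros y Hy E. rewrite E in Hy. lra.
- apply (continuous_locally_gt (fun y => sinch y * sinch y)); [|nra].
  apply (continuous_mult sinch sinch); apply continuous_sinch.
Qed.

Lemma is_derive_amp (x : R) : sinch x <> 0 -> is_derive (amp a s phi) x (amp' x).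
Proof.
intros H. apply (is_derive_ext_loc (polar (modexp a s) (phase a s) phi)).
- apply (filter_imp (fun y => sinch y <> 0)); [|apply locally_sinch_neq0, H].
  intros y Hy. unfold amp. destruct (Req_EM_T (sinch y) 0); [contradiction|reflexivity].
- apply (is_derive_polar (modexp a s) (phase a s) (p1 x) (r1 x));
    [apply is_derive_modexp, H|apply is_derive_phase, H].
Qed.

Lemma is_derive_amp' (x : R) : sinch x <> 0 -> is_derive amp' x (amp'' x).
Proof.
intros H. apply is_derive_polar'.
- apply is_derive_modexp, H.
- apply is_derive_phase, H.
- evar_last.
  + apply (is_derive_plus (fun x => a * (sinch' x / sinch x)) (fun _ => s / 2)).
    * apply is_derive_scal, is_derive_logmod', H.
    * apply (is_derive_const (K := R_AbsRing) (V := R_NormedModule)).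
  + unfold plus, zero, mu'; simpl. ring.
- evar_last.
  + apply (is_derive_minus (fun x => s * (sinch' x / sinch x)) (fun _ => a / 2)).
    * apply is_derive_scal, is_derive_logmod', H.
    * apply (is_derive_const (K := R_AbsRing) (V := R_NormedModule)).
  + unfold minus, plus, opp, zero, mu'; simpl. ring.
Qed.

Let b : R := Rmin a 2.

(** The modulus of Xi^w is |sinch|^a up to the bounded factor exp (- s Arg Xi). Two derivatives
    multiply it by quadratic expressions in the logarithmic derivative of [sinch], which is at most
    K / (1 + |x|) / |sinch|. The same K bounds [sinch] and [sinch'], so that zeros can be located
    later. *)
Lemma amp_bounds : exists C K, 0 < C /\ 1 <= K /\ forall x,
  Rabs (sinch x) <= K / (1 + Rabs x) /\ Rabs (sinch' x) <= K / (1 + Rabs x) /\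
  (sinch x <> 0 ->
    Rabs (amp a s phi x) <= C * Rpower (Rabs (sinch x)) b /\
    Rabs (amp'' x) <= C * Rpower (Rabs (sinch x)) b * (K / (1 + Rabs x) / Rabs (sinch x)) ^ 2).
Proof.
destruct sinch_bounds as [K [K1 HK]].
set (M := Rabs a + Rabs s).
assert (M1 : 1 < M) by (unfold M; pose proof (Rle_abs a); pose proof (Rabs_pos s); lra).
(* The first factor bounds exp (- s Arg Xi); the second lowers the exponent of |sinch| from a to b,
   since |sinch| <= K. *)
set (N := exp (Rabs s * PI) * Rpower K (a - b)).
assert (N0 : 0 < N) by (apply Rmult_lt_0_compat; apply exp_pos).
(* The coefficients of cos and sin in [polar''] add up to at most (|a| + |s|) |mu'| + (|p1| +
   |r1|)^2 <= 2 M u^2 + (4 M u)^2, with u as below. *)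
exists (N * (2 * M + 16 * M * M)), K.
split; [apply Rmult_lt_0_compat; nra|]. split; [exact K1|].
intros x. destruct (HK x) as [H0 [H1 H2]].
split; [exact H0|]. split; [exact H1|]. intros Hx.
set (D := K / (1 + Rabs x)) in *. set (S := Rabs (sinch x)) in *.
assert (S0 : 0 < S) by (apply Rabs_pos_lt, Hx).
assert (Hx1 := Rabs_pos x).
assert (DK : D <= K).
{ unfold D. apply Rle_div_l; [lra|]. nra. }
assert (P0 : 0 < Rpower S b) by apply exp_pos.
assert (EP : exp (modexp a s x) <= N * Rpower S b).
{ unfold modexp, logmod. fold S. unfold Rminus. rewrite exp_plus.
  assert (exp (- (s * ArgXi x)) <= exp (Rabs s * PI)).
  { apply exp_le. rewrite Ropp_mult_distr_l. eapply Rle_trans; [apply Rle_abs|].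
    rewrite Rabs_mult, Rabs_Ropp. apply Rmult_le_compat_l; [apply Rabs_pos|apply Arg_bound]. }
  assert (exp (a * ln S) <= Rpower K (a - b) * Rpower S b).
  { replace (a * ln S) with ((a - b) * ln S + b * ln S) by ring. rewrite exp_plus.
    apply Rmult_le_compat_r; [left; exact P0|].
    apply Rle_Rpower_l; [unfold b; pose proof (Rmin_l a 2); lra|lra]. }
  unfold N. pose proof (exp_pos (a * ln S)). pose proof (exp_pos (Rabs s * PI)).
  replace (exp (Rabs s * PI) * Rpower K (a - b) * Rpower S b)
    with ((Rpower K (a - b) * Rpower S b) * exp (Rabs s * PI)) by ring.
  apply Rmult_le_compat; try assumption; left; [assumption|apply exp_pos]. }
set (u := D / S).
(* As |sinch x| <= D, lower powers of u can be absorbed into u^2. *)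
assert (u1 : 1 <= u) by (apply Rle_div_r; lra).
assert (mu1 : Rabs (sinch' x / sinch x) <= u).
{ unfold u, Rdiv. rewrite Rabs_mult, Rabs_inv. fold S.
  apply Rmult_le_compat_r; [left; apply Rinv_0_lt_compat, S0|exact H1]. }
assert (mu2 : Rabs (mu' x) <= 2 * (u * u)).
{ unfold mu', Rminus. eapply Rle_trans; [apply Rabs_triang|]. rewrite Rabs_Ropp, Rabs_mult.
  assert (Rabs (sinch'' x / sinch x) <= u).
  { unfold u, Rdiv. rewrite Rabs_mult, Rabs_inv. fold S.
    apply Rmult_le_compat_r; [left; apply Rinv_0_lt_compat, S0|exact H2]. }
  pose proof (Rabs_pos (sinch' x / sinch x)). nra. }
assert (Ma : Rabs a <= M) by (unfold M; pose proof (Rabs_pos s); lra).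
assert (Ms : Rabs s <= M) by (unfold M; pose proof (Rabs_pos a); lra).
assert (HM : forall k l, Rabs k <= M -> Rabs l <= M ->
  Rabs (k * (sinch' x / sinch x) + l / 2) <= 2 * M * u).
{ intros k l Hk Hl. eapply Rle_trans; [apply Rabs_triang|].
  unfold Rdiv at 2. rewrite !Rabs_mult, (Rabs_pos_eq (/ 2)) by lra.
  pose proof (Rabs_pos (sinch' x / sinch x)). pose proof (Rabs_pos k). pose proof (Rabs_pos l).
  assert (Rabs k * Rabs (sinch' x / sinch x) <= M * u) by (apply Rmult_le_compat; lra). nra. }
assert (B1 : Rabs (p1 x) <= 2 * M * u) by (apply HM; assumption).
assert (B2 : Rabs (r1 x) <= 2 * M * u).
{ unfold r1. replace (s * (sinch' x / sinch x) - a / 2)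
    with (s * (sinch' x / sinch x) + (- a) / 2) by (unfold Rdiv; ring).
  apply HM; [assumption|rewrite Rabs_Ropp; assumption]. }
split.
- unfold amp. destruct (Req_EM_T (sinch x) 0); [contradiction|]. unfold polar.
  rewrite Rabs_mult, (Rabs_pos_eq (exp _)) by (left; apply exp_pos).
  assert (Rabs (cos (phase a s x + phi)) <= 1) by (apply Rabs_le, COS_bound).
  pose proof (exp_pos (modexp a s x)). pose proof (Rabs_pos (cos (phase a s x + phi))).
  apply Rle_trans with (N * Rpower S b); [nra|].
  apply Rmult_le_compat_r; [lra|]. nra.
- unfold amp'', polar''.
  rewrite Rabs_mult, (Rabs_pos_eq (exp _)) by (left; apply exp_pos).
  replace (N * (2 * M + 16 * M * M) * Rpower S b * u ^ 2)
    with ((N * Rpower S b) * ((2 * M + 16 * M * M) * (u * u))) by ring.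
  apply Rmult_le_compat; [left; apply exp_pos|apply Rabs_pos|exact EP|].
  eapply Rle_trans; [apply Rabs_trig_le|].
  assert (T1 : Rabs (a * mu' x + p1 x * p1 x - r1 x * r1 x)
    <= Rabs a * Rabs (mu' x) + Rabs (p1 x) * Rabs (p1 x) + Rabs (r1 x) * Rabs (r1 x)).
  { unfold Rminus. eapply Rle_trans; [apply Rabs_triang|]. rewrite Rabs_Ropp, Rabs_mult.
    apply Rplus_le_compat_r. eapply Rle_trans; [apply Rabs_triang|]. rewrite !Rabs_mult. lra. }
  assert (T2 : Rabs (s * mu' x + 2 * p1 x * r1 x)
    <= Rabs s * Rabs (mu' x) + 2 * Rabs (p1 x) * Rabs (r1 x)).
  { eapply Rle_trans; [apply Rabs_triang|]. rewrite !Rabs_mult, (Rabs_pos_eq 2) by lra. lra. }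
  assert (T3 : (Rabs a + Rabs s) * Rabs (mu' x) <= M * (2 * (u * u))).
  { apply Rmult_le_compat; [unfold M in M1; lra|apply Rabs_pos|unfold M; lra|exact mu2]. }
  assert (T4 : (Rabs (p1 x) + Rabs (r1 x)) * (Rabs (p1 x) + Rabs (r1 x))
    <= (4 * M * u) * (4 * M * u)).
  { pose proof (Rabs_pos (p1 x)). pose proof (Rabs_pos (r1 x)).
    apply Rmult_le_compat; lra. }
  nra.
Qed.

(** At a zero of Xi the argument jumps, but the modulus tends to 0. *)
Lemma continuous_amp (x : R) : continuous (amp a s phi) x.
Proof.
destruct (Req_dec (sinch x) 0) as [Hx|Hx].
- destruct amp_bounds as [C [K [C0 [_ HK]]]].
  assert (b1 : 1 < b) by (unfold b; apply Rmin_glb_lt; lra).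
  assert (E0 : amp a s phi x = 0).
  { unfold amp. destruct (Req_EM_T (sinch x) 0); [reflexivity|contradiction]. }
  (* near a zero of Xi, |amp| <= C |sinch| ^ b <= C |sinch| *)
  apply filterlim_locally. intros eps.
  assert (e0 : 0 < Rmin 1 (eps / C)).
  { apply Rmin_glb_lt; [lra|]. apply Rdiv_lt_0_compat; [apply cond_pos|exact C0]. }
  pose proof (proj1 (filterlim_locally _ _) (continuous_sinch x) (mkposreal _ e0)) as L.
  revert L. apply filter_imp. intros y Hy.
  rewrite E0. change (Rabs (amp a s phi y - 0) < eps). rewrite Rminus_0_r.
  change (Rabs (sinch y - sinch x) < Rmin 1 (eps / C)) in Hy.
  rewrite Hx, Rminus_0_r in Hy.
  destruct (Req_dec (sinch y) 0) as [Hy0|Hy0].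
  + unfold amp. destruct (Req_EM_T (sinch y) 0); [|contradiction].
    rewrite Rabs_R0. apply cond_pos.
  + destruct (HK y) as [_ [_ H]]. destruct (H Hy0) as [H1 _].
    eapply Rle_lt_trans; [exact H1|].
    assert (S0 : 0 < Rabs (sinch y)) by (apply Rabs_pos_lt, Hy0).
    pose proof (Rmin_l 1 (eps / C)). pose proof (Rmin_r 1 (eps / C)).
    assert (Rpower (Rabs (sinch y)) b <= Rabs (sinch y)).
    { rewrite <- (Rpower_1 (Rabs (sinch y))) at 2 by exact S0. unfold Rpower. apply exp_le.
      assert (ln (Rabs (sinch y)) < 0) by (rewrite <- ln_1; apply ln_increasing; lra). nra. }
    apply Rle_lt_trans with (C * Rabs (sinch y)); [nra|].
    assert (Q : Rabs (sinch y) < eps / C) by lra. apply Rlt_div_r in Q; [|exact C0]. lra.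
- apply (ex_derive_continuous (amp a s phi)). eexists. apply is_derive_amp, Hx.
Qed.

(* If |sinch x| is smaller than a multiple of h / (1 + |x|), then so is sinch at
   x + h and x - h and the three values of amp are small; otherwise sinch does not
   vanish on [x - h, x + h] and the second derivative is controlled there. *)
Lemma amp_second_difference : exists C, 0 < C /\ forall h x, 0 < h <= PI ->
  Rabs (amp a s phi (x + h) - 2 * amp a s phi x + amp a s phi (x - h))
    <= C * Rpower h b * Rpower (1 + Rabs x) (- b).
Proof.
destruct amp_bounds as [C [K [C0 [K1 HK]]]].
assert (b1 : 1 < b) by (unfold b; apply Rmin_glb_lt; lra).
assert (b2 : b <= 2) by apply Rmin_r.
exists (4 * C * Rpower (15 * K) b). split.
{ apply Rmult_lt_0_compat; [lra|apply exp_pos]. }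
intros h x Hh.
assert (Hx := Rabs_pos x).
set (D := K / (1 + Rabs x)).
assert (D0 : 0 < D) by (apply Rdiv_lt_0_compat; lra).
assert (Dh : 0 < D * h) by (apply Rmult_lt_0_compat; lra).
assert (P4 := PI_4).
assert (E : Rpower (15 * D * h) b
  = Rpower (15 * K) b * Rpower h b * Rpower (1 + Rabs x) (- b)).
{ unfold Rpower. rewrite <- !exp_plus. f_equal.
  replace (15 * D * h) with ((15 * K) * h * / (1 + Rabs x)) by (unfold D; field; lra).
  rewrite ln_mult, ln_mult, ln_Rinv; [ring|lra..| |].
  - apply Rmult_lt_0_compat; lra.
  - apply Rinv_0_lt_compat; lra. }
replace (4 * C * Rpower (15 * K) b * Rpower h b * Rpower (1 + Rabs x) (- b))
  with (4 * C * Rpower (15 * D * h) b) by (rewrite E; ring).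
(* The factor 5 is 1 + 4: as h <= PI <= 4, 1 + |x| <= 5 (1 + |y|). *)
assert (Dy : forall y, x - h <= y <= x + h -> K / (1 + Rabs y) <= 5 * D).
{ intros y Hy. assert (Hy0 := Rabs_pos y).
  assert (Rabs x <= Rabs y + h).
  { replace x with (y + (x - y)) by ring. eapply Rle_trans; [apply Rabs_triang|].
    apply Rplus_le_compat_l, Rabs_le. lra. }
  apply Rle_div_l; [lra|]. unfold D.
  replace (5 * (K / (1 + Rabs x)) * (1 + Rabs y))
    with (K * (5 * (1 + Rabs y)) / (1 + Rabs x)) by (field; lra).
  apply Rle_div_r; [lra|]. nra. }
assert (Lip : forall y, x - h <= y <= x + h -> Rabs (sinch y - sinch x) <= 5 * D * h).
{ intros y Hy. apply Rle_trans with (5 * D * Rabs (y - x)).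
  - apply (MVT_abs sinch sinch'); intros t Ht; [apply is_derive_sinch|].
    destruct (HK t) as [_ [H1 _]]. eapply Rle_trans; [exact H1|]. apply Dy.
    revert Ht. unfold Rmin, Rmax; repeat destruct Rle_dec; lra.
  - apply Rmult_le_compat_l; [lra|]. apply Rabs_le; lra. }
(* The threshold is twice the variation 5 D h of [sinch] on the interval: below it |sinch| stays at
   most 15 D h there, above it |sinch| stays larger than 5 D h. *)
destruct (Rle_lt_dec (Rabs (sinch x)) (10 * D * h)) as [Hs|Hs].
- assert (Q : forall y, x - h <= y <= x + h ->
    Rabs (amp a s phi y) <= C * Rpower (15 * D * h) b).
  { intros y Hy.
    destruct (Req_dec (sinch y) 0) as [Hy0|Hy0].
    - unfold amp. destruct (Req_EM_T (sinch y) 0); [|contradiction].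
      rewrite Rabs_R0. apply Rmult_le_pos; [lra|left; apply exp_pos].
    - destruct (HK y) as [_ [_ H]]. destruct (H Hy0) as [H1 _].
      eapply Rle_trans; [exact H1|]. apply Rmult_le_compat_l; [lra|].
      apply Rle_Rpower_l; [lra|]. split; [apply Rabs_pos_lt, Hy0|].
      specialize (Lip y Hy).
      replace (sinch y) with (sinch x + (sinch y - sinch x)) by ring.
      eapply Rle_trans; [apply Rabs_triang|]. lra. }
  assert (Q1 := Q (x + h) ltac:(lra)). assert (Q2 := Q x ltac:(lra)).
  assert (Q3 := Q (x - h) ltac:(lra)).
  unfold Rminus at 1.
  eapply Rle_trans; [apply Rabs_triang|].
  eapply Rle_trans; [apply Rplus_le_compat_r, Rabs_triang|].
  rewrite Rabs_Ropp, Rabs_mult, (Rabs_pos_eq 2) by lra. lra.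
- assert (Sy : forall y, x - h <= y <= x + h -> 5 * D * h < Rabs (sinch y)).
  { intros y Hy. specialize (Lip y Hy).
    assert (Rabs (sinch x) <= Rabs (sinch y) + Rabs (sinch y - sinch x)).
    { replace (sinch x) with (sinch y + - (sinch y - sinch x)) at 1 by ring.
      eapply Rle_trans; [apply Rabs_triang|]. rewrite Rabs_Ropp. lra. }
    lra. }
  assert (Ny : forall y, x - h <= y <= x + h -> sinch y <> 0).
  { intros y Hy E0. specialize (Sy y Hy). rewrite E0, Rabs_R0 in Sy. lra. }
  eapply Rle_trans.
  (* With S = |sinch t| > 5 D h, the second derivative is at most C S^(b-2) (5 D)^2 <= C (5 D
     h)^(b-2) (5 D)^2, which is this bound. *)
  + apply (second_difference (amp a s phi) amp' amp'' x h (C * Rpower (5 * D * h) b / (h * h)));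
      [lra| | |].
    * intros t Ht. apply is_derive_amp, Ny, Ht.
    * intros t Ht. apply is_derive_amp', Ny, Ht.
    * intros t Ht. destruct (HK t) as [_ [_ H]]. destruct (H (Ny t Ht)) as [_ H2].
      eapply Rle_trans; [exact H2|].
      set (S := Rabs (sinch t)). assert (St := Sy t Ht). fold S in St.
      assert (Dt := Dy t Ht). assert (P := exp_pos (b * ln S)). fold (Rpower S b) in P.
      assert (Dt0 : 0 <= K / (1 + Rabs t)).
      { apply Rlt_le, Rdiv_lt_0_compat; [lra|]. pose proof (Rabs_pos t). lra. }
      assert (S0 : 0 < S) by lra.
      apply Rle_trans with (C * (Rpower S b / (S * S)) * ((5 * D) * (5 * D))).
      -- replace (C * Rpower S b * (K / (1 + Rabs t) / S) ^ 2)
           with (C * (Rpower S b / (S * S)) * ((K / (1 + Rabs t)) * (K / (1 + Rabs t))))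
           by (pose proof (Rabs_pos t); field; repeat split; lra).
         apply Rmult_le_compat_l.
         ++ apply Rmult_le_pos; [lra|]. apply Rlt_le, Rdiv_lt_0_compat; nra.
         ++ apply Rmult_le_compat; lra.
      -- apply Rle_trans with (C * (Rpower (5 * D * h) b / ((5 * D * h) * (5 * D * h)))
           * ((5 * D) * (5 * D))).
         ++ apply Rmult_le_compat_r; [nra|]. apply Rmult_le_compat_l; [lra|].
            apply Rpower_div_sqr_anti; lra.
         ++ right. field. lra.
  + assert (Rpower (5 * D * h) b <= Rpower (15 * D * h) b) by (apply Rle_Rpower_l; lra).
    assert (0 < Rpower (5 * D * h) b) by apply exp_pos.
    replace (2 * (C * Rpower (5 * D * h) b / (h * h)) * (h * h))
      with (2 * C * Rpower (5 * D * h) b) by (field; lra).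
    nra.
Qed.

Lemma amp_decay : exists C, 0 < C /\
  forall x, Rabs (amp a s phi x) <= C * Rpower (1 + Rabs x) (- b).
Proof.
destruct amp_bounds as [C [K [C0 [K1 HK]]]].
exists (C * Rpower K b). split; [apply Rmult_lt_0_compat; [lra|apply exp_pos]|].
intros x. assert (Hx0 := Rabs_pos x).
destruct (Req_dec (sinch x) 0) as [Hx|Hx].
- unfold amp. destruct (Req_EM_T (sinch x) 0); [|contradiction]. rewrite Rabs_R0.
  apply Rmult_le_pos; [apply Rmult_le_pos; [lra|]|]; left; apply exp_pos.
- destruct (HK x) as [H1 [_ H]]. destruct (H Hx) as [H2 _].
  eapply Rle_trans; [exact H2|]. rewrite Rmult_assoc. apply Rmult_le_compat_l; [lra|].
  replace (Rpower K b * Rpower (1 + Rabs x) (- b)) with (Rpower (K / (1 + Rabs x)) b).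
  + apply Rle_Rpower_l; [unfold b; apply Rmin_glb; lra|]. split; [apply Rabs_pos_lt, Hx|exact H1].
  + unfold Rpower, Rdiv. rewrite <- exp_plus, ln_mult, ln_Rinv; [f_equal; ring|lra..|].
    apply Rinv_0_lt_compat; lra.
Qed.

End Amp.

(** * Improper integrals *)

(** [improper_int] restated with the relation [is_RInt], so that linearity and changes of variable
    apply without carrying proofs of integrability. *)
Definition has_int (f : R -> R) (L : R) : Prop :=
  forall eps, 0 < eps -> exists M, forall a b, a <= - M -> M <= b ->
  exists I, is_RInt f a b I /\ Rabs (I - L) < eps.

Lemma has_int_improper (f : R -> R) (L : R) : has_int f L -> improper_int f L.
Proof.
intros H eps He. destruct (H eps He) as [M HM]. exists M. intros a b Ha Hb.
destruct (HM a b Ha Hb) as [I [HI HL]].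
assert (E : ex_RInt f a b) by (eexists; exact HI).
exists (ex_RInt_Reals_0 f a b E).
rewrite <- RInt_Reals, (is_RInt_unique f a b I HI). exact HL.
Qed.

Lemma improper_int_unique (f : R -> R) (L L' : R) :
  improper_int f L -> improper_int f L' -> L = L'.
Proof.
intros H H'. apply cond_eq. intros eps He.
destruct (H (eps / 2)) as [M HM]; [lra|]. destruct (H' (eps / 2)) as [M' HM']; [lra|].
assert (A := Rmax_l M M'). assert (A' := Rmax_r M M').
destruct (HM (- Rmax M M') (Rmax M M')) as [pr Hpr]; [lra..|].
destruct (HM' (- Rmax M M') (Rmax M M')) as [pr' Hpr']; [lra..|].
rewrite <- RInt_Reals in Hpr, Hpr'.
apply Rabs_def2 in Hpr. apply Rabs_def2 in Hpr'. apply Rabs_def1; lra.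
Qed.

Lemma has_int_unique (f : R -> R) (L L' : R) : has_int f L -> has_int f L' -> L = L'.
Proof. intros H H'. apply (improper_int_unique f); apply has_int_improper; assumption. Qed.

(** Once some limit exists, the value selected by [epsilon] is a limit too, and limits are unique.
    [RsumZ_cv] repeats this for sums. *)
Lemma Rint_has_int (f : R -> R) (L : R) : has_int f L -> Rint f = L.
Proof.
intros H%has_int_improper. apply (improper_int_unique f); [|exact H].
unfold Rint. apply ClassicalEpsilon.epsilon_spec. exists L. exact H.
Qed.

Lemma has_int_ext (f g : R -> R) (L : R) : (forall x, f x = g x) -> has_int f L -> has_int g L.
Proof.
intros E H eps He. destruct (H eps He) as [M HM]. exists M. intros a b Ha Hb.
destruct (HM a b Ha Hb) as [I [HI HL]]. exists I. split; [|exact HL].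
apply (is_RInt_ext f); [|exact HI]. intros x _. apply E.
Qed.

Lemma has_int_plus (f g : R -> R) (L L' : R) :
  has_int f L -> has_int g L' -> has_int (fun x => f x + g x) (L + L').
Proof.
intros H H' eps He.
destruct (H (eps / 2)) as [M HM]; [lra|]. destruct (H' (eps / 2)) as [M' HM']; [lra|].
exists (Rmax M M'). intros a b Ha Hb.
assert (A := Rmax_l M M'). assert (A' := Rmax_r M M').
destruct (HM a b) as [I [HI HL]]; [lra..|]. destruct (HM' a b) as [I' [HI' HL']]; [lra..|].
exists (I + I'). split; [apply (is_RInt_plus f g a b I I'); assumption|].
apply Rabs_def2 in HL. apply Rabs_def2 in HL'. apply Rabs_def1; lra.
Qed.

Lemma has_int_scal (c : R) (f : R -> R) (L : R) :
  has_int f L -> has_int (fun x => c * f x) (c * L).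
Proof.
intros H eps He. assert (Hc := Rabs_pos c).
destruct (H (eps / (Rabs c + 1))) as [M HM]; [apply Rdiv_lt_0_compat; lra|].
exists M. intros a b Ha Hb. destruct (HM a b Ha Hb) as [I [HI HL]].
exists (c * I). split; [apply (is_RInt_scal f a b c I HI)|].
replace (c * I - c * L) with (c * (I - L)) by ring. rewrite Rabs_mult.
apply Rlt_div_r in HL; [|lra]. pose proof (Rabs_pos (I - L)). nra.
Qed.

Lemma has_int_shift (h : R) (f : R -> R) (L : R) :
  has_int f L -> has_int (fun x => f (x + h)) L.
Proof.
intros H eps He. destruct (H eps He) as [M HM]. exists (M + Rabs h). intros a b Ha Hb.
assert (Hh : - Rabs h <= h <= Rabs h).
{ split; [|apply Rle_abs]. pose proof (Rle_abs (- h)) as Q. rewrite Rabs_Ropp in Q. lra. }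
destruct (HM (a + h) (b + h)) as [I [HI HL]]; [lra..|]. exists I. split; [|exact HL].
apply (is_RInt_ext (fun y => scal 1 (f (1 * y + h)))).
- intros x _. change (1 * f (1 * x + h) = f (x + h)). rewrite !Rmult_1_l. reflexivity.
- apply (is_RInt_comp_lin f 1 h a b I). rewrite !Rmult_1_l. exact HI.
Qed.

Lemma has_int_reflect (f : R -> R) (L : R) : has_int f L -> has_int (fun x => f (- x)) L.
Proof.
intros H eps He. destruct (H eps He) as [M HM]. exists M. intros a b Ha Hb.
destruct (HM (- b) (- a)) as [I [HI HL]]; [lra..|]. exists I. split; [|exact HL].
apply is_RInt_swap, is_RInt_comp_opp, is_RInt_opp in HI.
change (opp (opp I)) with (- - I) in HI. rewrite Ropp_involutive in HI.
revert HI. apply is_RInt_ext. intros x _. apply Ropp_involutive.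
Qed.

(** * Integrals do not see the zeros of Xi *)

Lemma sinch_neq0_between (n : nat) (x : R) :
  2 * PI * INR n < x < 2 * PI * INR (S n) -> sinch x <> 0.
Proof.
intros H E. rewrite S_INR in H. pose proof PI_RGT_0 as P.
assert (Q := sinch_mul x). rewrite E, Rmult_0_r in Q.
destruct (sin_eq_0_0 (x / 2)) as [k Hk]; [lra|].
assert (x = 2 * PI * IZR k) by lra. subst x. rewrite INR_IZR_INZ in H.
assert (A : IZR (Z.of_nat n) < IZR k) by nra. apply lt_IZR in A.
assert (B : IZR k < IZR (Z.of_nat n + 1)) by (rewrite plus_IZR; nra). apply lt_IZR in B. lia.
Qed.

(** On [2 PI n, 2 PI (n+1)] the function can be nonzero only at the endpoints, which [is_RInt_ext]
    disregards; the pieces are then chained. *)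
Lemma is_RInt_null_pos (g : R -> R) : (forall x, sinch x <> 0 -> g x = 0) ->
  forall x, 0 <= x -> is_RInt g 0 x 0.
Proof.
intros Hg. pose proof PI_RGT_0 as P.
assert (Z : forall n x, 2 * PI * INR n <= x <= 2 * PI * INR (S n) ->
  is_RInt g (2 * PI * INR n) x 0).
{ intros n x Hx. apply (is_RInt_ext (fun _ => 0)).
  - intros y Hy. symmetry. apply Hg, (sinch_neq0_between n).
    rewrite Rmin_left, Rmax_right in Hy by lra. lra.
  - evar_last; [apply (is_RInt_const (V := R_NormedModule))|].
    unfold scal; simpl; unfold mult; simpl. ring. }
assert (Q : forall n, is_RInt g 0 (2 * PI * INR n) 0).
{ induction n as [|n IH].
  - simpl INR. rewrite Rmult_0_r. apply (is_RInt_point g 0).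
  - replace 0 with (plus 0 0) at 2 by (unfold plus; simpl; ring).
    apply (is_RInt_Chasles g _ (2 * PI * INR n)); [exact IH|]. apply Z.
    rewrite S_INR. nra. }
intros x Hx. destruct (nfloor_ex (x / (2 * PI))) as [n [H1 H2]].
{ apply Rdiv_le_0_compat; lra. }
apply Rle_div_r in H1; [|lra]. apply Rlt_div_l in H2; [|lra].
replace 0 with (plus 0 0) at 2 by (unfold plus; simpl; ring).
apply (is_RInt_Chasles g _ (2 * PI * INR n)); [apply Q|]. apply Z. rewrite S_INR. lra.
Qed.

Lemma is_RInt_null (g : R -> R) : (forall x, sinch x <> 0 -> g x = 0) ->
  forall a b, is_RInt g a b 0.
Proof.
intros Hg.
assert (H : forall x, is_RInt g 0 x 0).
{ intros x. destruct (Rle_lt_dec 0 x) as [Hx|Hx]; [apply is_RInt_null_pos; assumption|].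
  apply (is_RInt_ext (fun y => opp (- g (- - y)))).
  - intros y _. rewrite (Ropp_involutive y). apply Ropp_involutive.
  - apply (is_RInt_comp_opp (fun y => - g (- y)) 0 x 0). rewrite Ropp_0.
    apply is_RInt_null_pos; [|lra]. intros y Hy. rewrite Hg; [ring|]. rewrite sinch_opp. exact Hy. }
intros a b. replace 0 with (plus (opp 0) 0) by (unfold plus, opp; simpl; ring).
apply (is_RInt_Chasles g _ 0); [apply (is_RInt_swap g a 0 0)|]; apply H.
Qed.

(** This removes the discrepancy between [amp] and the integrands of [Bw] and [Bq], whose default
    values at the zeros of Xi differ. *)
Lemma has_int_ae (f g : R -> R) (L : R) :
  (forall x, sinch x <> 0 -> f x = g x) -> has_int f L -> has_int g L.
Proof.
intros E H eps He. destruct (H eps He) as [M HM]. exists M. intros a b Ha Hb.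
destruct (HM a b Ha Hb) as [I [HI HL]]. exists I. split; [|exact HL].
apply (is_RInt_ext (fun x => plus (f x) (g x - f x))).
- intros x _. unfold plus; simpl. ring.
- replace I with (plus I 0) by (unfold plus; simpl; ring).
  apply (is_RInt_plus f (fun x => g x - f x)); [exact HI|].
  apply is_RInt_null. intros x Hx. rewrite (E x Hx). ring.
Qed.

(** The integral of (1 + t)^(-b) over [x, infinity), for b > 1. *)
Definition tail (b x : R) : R := Rpower (1 + x) (1 - b) / (b - 1).

Lemma is_derive_tail (b x : R) : 1 < b -> 0 <= x ->
  is_derive (tail b) x (- Rpower (1 + x) (- b)).
Proof.
intros Hb Hx. unfold tail, Rpower. auto_derive; [lra|].
replace ((1 - b) * ln (1 + x)) with (- b * ln (1 + x) + ln (1 + x)) by ring.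
rewrite exp_plus, exp_ln by lra. field. lra.
Qed.

Lemma tail_pos (b x : R) : 1 < b -> 0 < tail b x.
Proof. intros Hb. apply Rdiv_lt_0_compat; [apply exp_pos|lra]. Qed.

Lemma tail_0 (b : R) : 1 < b -> tail b 0 = / (b - 1).
Proof.
intros Hb. unfold tail, Rpower. rewrite Rplus_0_r, ln_1, Rmult_0_r, exp_0. field. lra.
Qed.

Lemma tail_small (b eps : R) : 1 < b -> 0 < eps -> exists M, 0 <= M /\
  forall x, M <= x -> tail b x < eps.
Proof.
intros Hb He.
assert (He' : 0 < eps * (b - 1)) by nra.
(* Solves (1 - b) ln (1 + x) < ln (eps (b - 1)) for ln (1 + x). *)
set (Y := Rmax 0 (1 - ln (eps * (b - 1)) / (b - 1))).
assert (Y0 : 0 <= Y) by apply Rmax_l.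
assert (Y1 : 1 - ln (eps * (b - 1)) / (b - 1) <= Y) by apply Rmax_r.
exists (exp Y). split; [left; apply exp_pos|]. intros x Hx.
unfold tail, Rpower. apply Rlt_div_l; [lra|].
rewrite <- (exp_ln (eps * (b - 1))) by exact He'. apply exp_increasing.
assert (Y < ln (1 + x)).
{ pose proof (exp_pos Y). rewrite <- (ln_exp Y). apply ln_increasing; lra. }
assert (ln (eps * (b - 1)) = (b - 1) * (ln (eps * (b - 1)) / (b - 1))) by (field; lra).
nra.
Qed.

Lemma ex_RInt_cont (f : R -> R) (u v : R) : (forall x, continuous f x) -> ex_RInt f u v.
Proof.
intros Hf. apply (ex_RInt_continuous (V := R_CompleteNormedModule)). intros; apply Hf.
Qed.

Lemma RInt_tail (b C : R) (f : R -> R) (u v : R) : 1 < b -> 0 <= C ->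
  (forall x, continuous f x) ->
  (forall x, Rabs (f x) <= C * Rpower (1 + Rabs x) (- b)) ->
  0 <= u <= v -> Rabs (RInt f u v) <= C * tail b u.
Proof.
intros b1 C0 Hc Hf Huv.
apply Rle_trans with (C * (tail b u - tail b v)).
- apply (norm_RInt_le f (fun x => C * Rpower (1 + x) (- b)) u v); [lra| | |].
  + intros x Hx. rewrite <- (Rabs_pos_eq x) at 2 by lra. apply Hf.
  + apply (RInt_correct f u v), ex_RInt_cont, Hc.
  + replace (C * (tail b u - tail b v)) with (minus (- C * tail b v) (- C * tail b u))
      by (unfold minus, plus, opp; simpl; ring).
    apply (is_RInt_derive (V := R_CompleteNormedModule) (fun x => - C * tail b x)).
    * rewrite Rmin_left by lra. intros x Hx. evar_last.
      -- apply is_derive_scal, is_derive_tail; lra.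
      -- simpl. ring.
    * rewrite Rmin_left by lra. intros x Hx.
      apply (ex_derive_continuous (fun x => C * Rpower (1 + x) (- b))).
      unfold Rpower. auto_derive. lra.
- apply Rmult_le_compat_l; [exact C0|]. pose proof (tail_pos b v b1). lra.
Qed.

(** The integral over a window containing [-n, n] differs from that over [-n, n] by at most two
    tails at n. So the symmetric windows form a Cauchy sequence, and their limit serves all
    windows. *)
Lemma has_int_exists (b C : R) (f : R -> R) : 1 < b -> 0 <= C ->
  (forall x, continuous f x) ->
  (forall x, Rabs (f x) <= C * Rpower (1 + Rabs x) (- b)) ->
  exists L, has_int f L /\ Rabs L <= 2 * C / (b - 1).
Proof.
intros b1 C0 Hc Hf.
assert (Ex : forall u v, ex_RInt f u v) by (intros; apply ex_RInt_cont, Hc).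
assert (Hneg : forall u v, 0 <= u <= v -> Rabs (RInt f (- v) (- u)) <= C * tail b u).
{ intros u v Huv.
  replace (RInt f (- v) (- u)) with (RInt (fun y => f (- y)) u v).
  - apply RInt_tail; [exact b1|exact C0| | |exact Huv].
    + intros x. apply (continuous_comp Ropp f); [|apply Hc].
      apply (ex_derive_continuous Ropp). auto_derive. exact I.
    + intros x. rewrite <- (Rabs_Ropp x). apply Hf.
  - apply is_RInt_unique.
    assert (H := RInt_correct f (- v) (- u) (Ex _ _)).
    apply is_RInt_swap, is_RInt_comp_opp, is_RInt_opp in H.
    change (opp (opp (RInt f (- v) (- u)))) with (- - RInt f (- v) (- u)) in H.
    rewrite Ropp_involutive in H.
    revert H. apply is_RInt_ext. intros x _. apply Ropp_involutive. }
assert (Diff : forall n a c, 0 <= n -> a <= - n -> n <= c ->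
  Rabs (RInt f a c - RInt f (- n) n) <= 2 * C * tail b n).
{ intros n a c Hn Ha Hc'.
  rewrite <- (RInt_Chasles f a (- n) c), <- (RInt_Chasles f (- n) n c) by apply Ex.
  unfold plus; simpl.
  replace (RInt f a (- n) + (RInt f (- n) n + RInt f n c) - RInt f (- n) n)
    with (RInt f (- - a) (- n) + RInt f n c) by (rewrite Ropp_involutive; ring).
  eapply Rle_trans; [apply Rabs_triang|].
  assert (H1 := Hneg n (- a) ltac:(lra)).
  assert (H2 := RInt_tail b C f n c b1 C0 Hc Hf ltac:(lra)). lra. }
set (J := fun n => RInt f (- INR n) (INR n)).
assert (small : forall eps, 0 < eps -> exists n, forall m, (n <= m)%nat ->
  2 * C * tail b (INR m) < eps).
{ intros eps He. destruct (tail_small b (eps / (2 * C + 1)) b1) as [M [M0 HM]].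
  { apply Rdiv_lt_0_compat; lra. }
  destruct (nfloor_ex M M0) as [n [_ Hn]]. exists (S n). intros m Hm.
  apply le_INR in Hm. rewrite S_INR in Hm.
  specialize (HM (INR m) ltac:(lra)). apply Rlt_div_r in HM; [|lra].
  pose proof (tail_pos b (INR m) b1). nra. }
assert (Cau : Cauchy_crit J).
{ intros eps He. destruct (small (eps / 2)) as [n Hn]; [lra|]. exists n. intros p q Hp Hq.
  unfold Rdist.
  assert (Hp' := le_INR _ _ Hp). assert (Hq' := le_INR _ _ Hq). assert (n0 := pos_INR n).
  assert (D1 := Diff (INR n) (- INR p) (INR p) n0 ltac:(lra) Hp').
  assert (D2 := Diff (INR n) (- INR q) (INR q) n0 ltac:(lra) Hq').
  specialize (Hn n (Nat.le_refl n)).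
  fold (J n) (J p) in D1. fold (J n) (J q) in D2.
  apply Rabs_le_between in D1. apply Rabs_le_between in D2. apply Rabs_def1; lra. }
destruct (Rcomplete.R_complete J Cau) as [L HL].
assert (JL : forall n, Rabs (L - J n) <= 2 * C * tail b (INR n)).
{ intros n. apply le_epsilon. intros eps He. destruct (HL eps He) as [N HN].
  specialize (HN (max n N) ltac:(lia)). unfold Rdist in HN.
  assert (H' : INR n <= INR (max n N)) by (apply le_INR; lia).
  assert (D := Diff (INR n) (- INR (max n N)) (INR (max n N)) (pos_INR n) ltac:(lra) H').
  fold (J n) (J (max n N)) in D. apply Rabs_le_between in D. apply Rabs_def2 in HN.
  apply Rabs_le. lra. }
exists L. split.
- intros eps He. destruct (small (eps / 2)) as [n Hn]; [lra|].
  exists (INR n). intros a c Ha Hc'. exists (RInt f a c). split; [apply (RInt_correct f a c), Ex|].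
  assert (D := Diff (INR n) a c (pos_INR n) Ha Hc'). fold (J n) in D.
  specialize (JL n). specialize (Hn n (Nat.le_refl n)).
  apply Rabs_le_between in D. apply Rabs_le_between in JL. apply Rabs_def1; lra.
(* At n = 0 the window is a point and [tail b 0] is 1 / (b - 1). *)
- specialize (JL O). unfold J in JL. simpl INR in JL.
  rewrite Ropp_0, RInt_point, tail_0 in JL by exact b1.
  unfold zero in JL; simpl in JL. rewrite Rminus_0_r in JL. exact JL.
Qed.

(* With h = PI / |t|, shifting by h and by - h flips the sign of the cosine, so that
   the integral of (second difference of f) * cos is - 4 times the integral of f * cos. *)
Lemma oscillatory_decay (b C C' : R) (f : R -> R) : 1 < b -> 0 <= C -> 0 <= C' ->
  (forall x, continuous f x) ->
  (forall x, Rabs (f x) <= C * Rpower (1 + Rabs x) (- b)) ->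
  (forall h x, 0 < h <= PI -> Rabs (f (x + h) - 2 * f x + f (x - h))
    <= C' * Rpower h b * Rpower (1 + Rabs x) (- b)) ->
  forall t phi L, 1 <= Rabs t -> has_int (fun x => f x * cos (t * x + phi)) L ->
  Rabs L <= C' * Rpower PI b / (b - 1) * Rpower (Rabs t) (- b).
Proof.
intros b1 C0 C0' Hc Hf Hd t phi L Ht HL.
set (h := PI / Rabs t). assert (P := PI_RGT_0).
assert (Hh : 0 < h <= PI).
(* Here |t| >= 1 is used: it brings h into the range of the second difference bound. *)
{ unfold h. split; [apply Rdiv_lt_0_compat; lra|]. apply Rle_div_l; nra. }
assert (Hcos : forall x, cos (t * (x + h) + phi) = - cos (t * x + phi) /\
  cos (t * (x - h) + phi) = - cos (t * x + phi)).
{ intros x.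
  assert (Hth : t * h = PI \/ t * h = - PI).
  { unfold h. destruct (Rle_lt_dec 0 t).
    - left. rewrite Rabs_pos_eq in * by lra. field. lra.
    - right. rewrite Rabs_left in * by lra. field. lra. }
  assert (T : forall y, cos (y + PI) = - cos y /\ cos (y - PI) = - cos y).
  { intros y. split; [apply neg_cos|].
    rewrite <- (cos_neg (y - PI)).
    replace (- (y - PI)) with (- y + PI) by ring. rewrite neg_cos, cos_neg. reflexivity. }
  destruct (T (t * x + phi)) as [T1 T2].
  destruct Hth as [E|E]; split.
  - rewrite <- T1. f_equal. rewrite <- E. ring.
  - rewrite <- T2. f_equal. rewrite <- E. ring.
  - rewrite <- T2. f_equal. replace PI with (- (t * h)) by lra. ring.
  - rewrite <- T1. f_equal. replace PI with (- (t * h)) by lra. ring. }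
set (g := fun x => (f (x + h) - 2 * f x + f (x - h)) * cos (t * x + phi)).
assert (I1 : has_int g (-1 * L + -2 * L + -1 * L)).
{ apply (has_int_ext (fun x => -1 * (f (x + h) * cos (t * (x + h) + phi))
    + -2 * (f x * cos (t * x + phi)) + -1 * (f (x + - h) * cos (t * (x + - h) + phi)))).
  - intros x. destruct (Hcos x) as [E1 E2]. unfold g. fold (x - h). rewrite E1, E2. ring.
  - apply (has_int_plus (fun x => -1 * (f (x + h) * cos (t * (x + h) + phi))
      + -2 * (f x * cos (t * x + phi)))); [apply has_int_plus|];
      apply has_int_scal; [|exact HL|].
    + apply (has_int_shift h _ _ HL).
    + apply (has_int_shift (- h) _ _ HL). }
destruct (has_int_exists b (C' * Rpower h b) g b1) as [L' [HL' HB]].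
- apply Rmult_le_pos; [lra|left; apply exp_pos].
- intros x. apply (continuous_mult (fun x => f (x + h) - 2 * f x + f (x - h))
    (fun x => cos (t * x + phi))).
  + assert (T : forall k, continuous (fun x => f (x + k)) x).
    { intros k. apply (continuous_comp (fun x => x + k) f); [|apply Hc].
      apply (ex_derive_continuous (fun x => x + k)). auto_derive. exact I. }
    apply (continuous_plus (fun x => f (x + h) - 2 * f x) (fun x => f (x - h))); [|apply (T (- h))].
    apply (continuous_minus (fun x => f (x + h)) (fun x => 2 * f x)); [apply T|].
    apply (continuous_scal_r 2 f), Hc.
  + apply (ex_derive_continuous (fun x => cos (t * x + phi))). auto_derive. exact I.
- intros x. unfold g. rewrite Rabs_mult.
  assert (Rabs (cos (t * x + phi)) <= 1) by (apply Rabs_le, COS_bound).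
  specialize (Hd h x Hh). pose proof (Rabs_pos (cos (t * x + phi))).
  pose proof (Rabs_pos (f (x + h) - 2 * f x + f (x - h))). nra.
(* The integral of g is - 4 L and has absolute value at most 2 C' h^b / (b - 1), which leaves a
   factor 2 to spare. *)
- assert (E := has_int_unique _ _ _ I1 HL').
  assert (E4 : Rabs L' = 4 * Rabs L).
  { rewrite <- E. replace (-1 * L + -2 * L + -1 * L) with ((- 4) * L) by ring.
    rewrite Rabs_mult, Rabs_left by lra. ring. }
  assert (Eh : Rpower h b = Rpower PI b * Rpower (Rabs t) (- b)).
  { unfold Rpower, h, Rdiv. rewrite <- exp_plus, ln_mult, ln_Rinv; [f_equal; ring|lra..|].
    apply Rinv_0_lt_compat; lra. }
  rewrite E4, Eh in HB.
  set (X := C' * (Rpower PI b * Rpower (Rabs t) (- b))) in *.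
  replace (C' * Rpower PI b / (b - 1) * Rpower (Rabs t) (- b)) with (X / (b - 1))
    by (unfold X; field; lra).
  assert (X0 : 0 <= X).
  { unfold X. repeat apply Rmult_le_pos; [lra|left; apply exp_pos..]. }
  assert (0 <= X / (b - 1)) by (apply Rdiv_le_0_compat; lra).
  replace (2 * X / (b - 1)) with (2 * (X / (b - 1))) in HB by (field; lra). lra.
Qed.

(** * Complex arithmetic, integrals and sums *)

Lemma Cx_eq (x y : Cx) : Re x = Re y -> Im x = Im y -> x = y.
Proof. destruct x, y; simpl; intros -> ->; reflexivity. Qed.

Lemma Cx_ring : ring_theory C0 C1 Cadd Cmul Csub Copp eq.
Proof. constructor; intros; apply Cx_eq; simpl; ring. Qed.

Add Ring Cx_ring : Cx_ring.

Lemma Cexp_add (x y : Cx) : Cexp (Cadd x y) = Cmul (Cexp x) (Cexp y).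
Proof. apply Cx_eq; simpl; rewrite exp_plus, ?cos_plus, ?sin_plus; ring. Qed.

(** Writing 1 / (2 i) as - i / 2 turns the division into a product, within reach of [ring]. *)
Lemma Csin_half (x : Cx) :
  Csin x = Cmul (mkC 0 (- / 2)) (Csub (Cexp (Cmul Ci x)) (Cexp (Copp (Cmul Ci x)))).
Proof. apply Cx_eq; unfold Csin, Cdiv, Cinv, Cnorm2; simpl; field. Qed.

Definition Chas_int (f : R -> Cx) (L : Cx) : Prop :=
  has_int (fun x => Re (f x)) (Re L) /\ has_int (fun x => Im (f x)) (Im L).

Lemma Cint_has_int (f : R -> Cx) (L : Cx) : Chas_int f L -> Cint f = L.
Proof. intros [H1 H2]. apply Cx_eq; simpl; apply Rint_has_int; assumption. Qed.

Lemma Chas_int_plus (f g : R -> Cx) (L L' : Cx) : Chas_int f L -> Chas_int g L' ->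
  Chas_int (fun x => Cadd (f x) (g x)) (Cadd L L').
Proof. intros [H1 H2] [H3 H4]. split; simpl; apply has_int_plus; assumption. Qed.

Lemma Chas_int_scal (c : Cx) (f : R -> Cx) (L : Cx) : Chas_int f L ->
  Chas_int (fun x => Cmul c (f x)) (Cmul c L).
Proof.
intros [H1 H2]. split; simpl.
- replace (Re c * Re L - Im c * Im L) with (Re c * Re L + (- Im c) * Im L) by ring.
  apply (has_int_ext (fun x => Re c * Re (f x) + (- Im c) * Im (f x))); [intros; ring|].
  apply has_int_plus; apply has_int_scal; assumption.
- apply has_int_plus; apply has_int_scal; assumption.
Qed.

Lemma Chas_int_ae (f g : R -> Cx) (L : Cx) : (forall x, sinch x <> 0 -> f x = g x) ->
  Chas_int f L -> Chas_int g L.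
Proof.
intros E [H1 H2]. split; [revert H1|revert H2]; apply has_int_ae; intros x Hx; rewrite E; trivial.
Qed.

(** * Fourier integrals and B-splines *)

Lemma amp_integral (a s phi : R) : 1 < a -> exists C, 0 <= C /\ forall t psi, exists L,
  has_int (fun x => amp a s phi x * cos (t * x + psi)) L /\
  (1 <= Rabs t -> Rabs L <= C * Rpower (Rabs t) (- Rmin a 2)).
Proof.
intros a1.
assert (b1 : 1 < Rmin a 2) by (apply Rmin_glb_lt; lra).
destruct (amp_decay a s phi a1) as [C [C0 HC]].
destruct (amp_second_difference a s phi a1) as [C' [C0' HC']].
assert (Hc := continuous_amp a s phi a1).
exists (C' * Rpower PI (Rmin a 2) / (Rmin a 2 - 1)). split.
{ apply Rdiv_le_0_compat; [|lra]. apply Rmult_le_pos; [lra|left; apply exp_pos]. }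
intros t psi.
destruct (has_int_exists (Rmin a 2) C (fun x => amp a s phi x * cos (t * x + psi)))
  as [L [HL _]]; [exact b1|lra| | |].
- intros x. apply (continuous_mult (amp a s phi) (fun x => cos (t * x + psi))); [apply Hc|].
  apply (ex_derive_continuous (fun x => cos (t * x + psi))). auto_derive. exact I.
- intros x. rewrite Rabs_mult.
  assert (Rabs (cos (t * x + psi)) <= 1) by (apply Rabs_le, COS_bound).
  specialize (HC x). pose proof (Rabs_pos (amp a s phi x)).
  pose proof (Rabs_pos (cos (t * x + psi))). nra.
- exists L. split; [exact HL|]. intros Ht.
  apply (oscillatory_decay _ C C' (amp a s phi)) with (phi := psi); try assumption; lra.
Qed.

Definition Xipow (w : Cx) (x : R) : Cx := Cexp (Cmul w (Clog (Xi x))).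

Definition Bw_integrand (w : Cx) (t x : R) : Cx :=
  Cmul (Xipow w x) (Cexp (Cmul Ci (RtoC (x * t)))).

Lemma Xipow_polar (a s x : R) : Xipow (mkC a s) x =
  mkC (exp (modexp a s x) * cos (phase a s x)) (exp (modexp a s x) * sin (phase a s x)).
Proof.
unfold Xipow, Clog, modexp, phase, logmod. fold (ArgXi x). rewrite Cabs_Xi.
apply Cx_eq; simpl; do 2 f_equal; ring.
Qed.

Lemma Xipow_amp (a s x : R) : sinch x <> 0 ->
  Xipow (mkC a s) x = mkC (amp a s 0 x) (amp a s (- (PI / 2)) x).
Proof.
intros H. rewrite Xipow_polar. unfold amp, polar.
destruct (Req_EM_T (sinch x) 0); [contradiction|].
f_equal; [rewrite Rplus_0_r; reflexivity|].
f_equal. rewrite cos_plus, cos_neg, sin_neg, cos_PI2, sin_PI2. ring.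
Qed.

(** Off the zeros, the real and imaginary parts of Xi^w exp (i t x) are sums of two products of an
    [amp] with cos (t x + psi), where psi = 0 or psi = PI / 2 or psi = - PI / 2. Four integrals of
    that type suffice, with a constant independent of t. *)
Lemma Bw_integral (a s : R) : 1 < a -> exists C, 0 <= C /\ forall t, exists I,
  Chas_int (Bw_integrand (mkC a s) t) I /\
  (1 <= Rabs t -> Rabs (Re I) <= C * Rpower (Rabs t) (- Rmin a 2) /\
                  Rabs (Im I) <= C * Rpower (Rabs t) (- Rmin a 2)).
Proof.
intros a1.
destruct (amp_integral a s 0 a1) as [C [C0 H]].
destruct (amp_integral a s (- (PI / 2)) a1) as [C' [C0' H']].
exists (C + C'). split; [lra|]. intros t.
destruct (H t 0) as [L1 [I1 B1]]. destruct (H' t (PI / 2)) as [L2 [I2 B2]].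
destruct (H t (- (PI / 2))) as [L3 [I3 B3]]. destruct (H' t 0) as [L4 [I4 B4]].
assert (Cp : forall y, cos (y + PI / 2) = - sin y).
{ intros y. rewrite cos_plus, cos_PI2, sin_PI2. ring. }
assert (Cm : forall y, cos (y + - (PI / 2)) = sin y).
{ intros y. rewrite cos_plus, cos_neg, sin_neg, cos_PI2, sin_PI2. ring. }
exists (mkC (L1 + L2) (L3 + L4)). split.
- apply (Chas_int_ae (fun x => mkC
    (amp a s 0 x * cos (t * x + 0) + amp a s (- (PI / 2)) x * cos (t * x + PI / 2))
    (amp a s 0 x * cos (t * x + - (PI / 2)) + amp a s (- (PI / 2)) x * cos (t * x + 0)))).
  + intros x Hx. unfold Bw_integrand. rewrite Xipow_amp by exact Hx.
    rewrite Cp, Cm, Rplus_0_r.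
    apply Cx_eq; simpl; replace (0 * (x * t) - 1 * 0) with 0 by ring;
      replace (0 * 0 + 1 * (x * t)) with (t * x) by ring; rewrite exp_0; ring.
  + split; simpl; apply has_int_plus; assumption.
- simpl. intros Ht. specialize (B1 Ht). specialize (B2 Ht). specialize (B3 Ht). specialize (B4 Ht).
  split; (eapply Rle_trans; [apply Rabs_triang|]); lra.
Qed.

Lemma Bw_eq (w : Cx) (t : R) (I : Cx) : Chas_int (Bw_integrand w t) I ->
  Bw w t = Cmul (RtoC (/ (2 * PI))) I.
Proof. intros H. unfold Bw. f_equal. apply Cint_has_int, H. Qed.

(** Under s -> - s and x -> - x together, [modexp] is unchanged and [phase] changes sign, as
    [logmod] is even and [ArgXi] odd. *)
Lemma Bw_integrand_conj (w : Cx) (t x : R) :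
  Bw_integrand (Cconj w) t x = Cconj (Bw_integrand w t (- x)).
Proof.
destruct w as [a s]. unfold Bw_integrand, Cconj at 1; simpl Re; simpl Im.
rewrite !Xipow_polar. unfold modexp, phase, logmod. rewrite ArgXi_opp, sinch_opp.
replace (- s * ln (Rabs (sinch x)) + a * ArgXi x)
  with (- (s * ln (Rabs (sinch x)) + a * - ArgXi x)) by ring.
replace (a * ln (Rabs (sinch x)) - - s * ArgXi x)
  with (a * ln (Rabs (sinch x)) - s * - ArgXi x) by ring.
rewrite cos_neg, sin_neg.
apply Cx_eq; simpl; replace (0 * (- x * t) - 1 * 0) with 0 by ring;
  replace (0 * (x * t) - 1 * 0) with 0 by ring;
  replace (0 * 0 + 1 * (- x * t)) with (- (0 * 0 + 1 * (x * t))) by ring;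
  rewrite cos_neg, sin_neg; ring.
Qed.

Lemma Chas_int_Bw_conj (w : Cx) (t : R) (I : Cx) : Chas_int (Bw_integrand w t) I ->
  Chas_int (Bw_integrand (Cconj w) t) (Cconj I).
Proof.
intros [H1 H2]. split.
- apply has_int_reflect in H1. revert H1. apply has_int_ext. intros x.
  rewrite Bw_integrand_conj. reflexivity.
- apply has_int_reflect in H2. apply (has_int_scal (-1)) in H2.
  replace (Im (Cconj I)) with (-1 * Im I) by (simpl; ring). revert H2. apply has_int_ext. intros x.
  rewrite Bw_integrand_conj. simpl. ring.
Qed.

Lemma Bw_conj (w : Cx) (t : R) : 1 < Re w -> Bw (Cconj w) t = Cconj (Bw w t).
Proof.
destruct w as [a s]. simpl. intros a1. destruct (Bw_integral a s a1) as [C [_ H]].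
destruct (H t) as [I [HI _]].
rewrite (Bw_eq _ _ _ HI), (Bw_eq _ _ _ (Chas_int_Bw_conj _ _ _ HI)).
apply Cx_eq; simpl; ring.
Qed.

(** At a zero of Xi the left side is 0 and the right side is exp w, hence the hypothesis. *)
Lemma Ccpow_Xi (a x : R) (w : Cx) : sinch x <> 0 ->
  Cmul (Ccpow (Xi x) (RtoC a)) (Cexp w) = Cexp (Cadd (Cmul (RtoC a) (Clog (Xi x))) w).
Proof.
intros Hx. unfold Ccpow. destruct (Req_EM_T (Cnorm2 (Xi x)) 0) as [E|_].
- exfalso. apply Hx. pose proof (Cabs_Xi x) as Q. unfold Cabs in Q. rewrite E, sqrt_0 in Q.
  destruct (Req_dec (sinch x) 0) as [|N]; [assumption|]. apply Rabs_no_R0 in N. lra.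
- symmetry. apply Cexp_add.
Qed.

Lemma HCpowq_Xi (a v1 v2 v3 x : R) : sinch x <> 0 ->
  let s := vnorm v1 v2 v3 in
  let sn := Cmul (mkC 0 (- / 2)) (Csub (Xipow (mkC a s) x) (Xipow (mkC a (- s)) x)) in
  HCpowq (Xi x) a v1 v2 v3 =
  mkHC (Cmul (RtoC (/ 2)) (Cadd (Xipow (mkC a s) x) (Xipow (mkC a (- s)) x)))
    (Cmul (RtoC (v1 / s)) sn) (Cmul (RtoC (v2 / s)) sn) (Cmul (RtoC (v3 / s)) sn).
Proof.
intros Hx s sn. unfold HCpowq. fold s.
set (L := Cmul (RtoC s) (Clog (Xi x))).
assert (E1 : Cmul (Ccpow (Xi x) (RtoC a)) (Cexp (Cmul Ci L)) = Xipow (mkC a s) x).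
{ rewrite Ccpow_Xi by exact Hx. unfold Xipow, L. f_equal. apply Cx_eq; simpl; ring. }
assert (E2 : Cmul (Ccpow (Xi x) (RtoC a)) (Cexp (Copp (Cmul Ci L))) = Xipow (mkC a (- s)) x).
{ rewrite Ccpow_Xi by exact Hx. unfold Xipow, L. f_equal. apply Cx_eq; simpl; ring. }
assert (E3 : Cmul (Ccpow (Xi x) (RtoC a)) (Csin L) = sn).
{ unfold sn. rewrite Csin_half, <- E1, <- E2. ring. }
rewrite E3. f_equal. unfold Ccos. rewrite <- E1, <- E2. ring.
Qed.

Lemma Bq_Bw (a v1 v2 v3 t : R) : 1 < a ->
  let s := vnorm v1 v2 v3 in
  let B := Bw (mkC a s) t in
  Bq a v1 v2 v3 t = mkHC (RtoC (Re B)) (RtoC (v1 / s * Im B))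
    (RtoC (v2 / s * Im B)) (RtoC (v3 / s * Im B)).
Proof.
intros a1 s B.
destruct (Bw_integral a s a1) as [C [_ H]]. destruct (H t) as [I [HI _]].
assert (HI' := Chas_int_Bw_conj _ _ _ HI). unfold Cconj at 1 in HI'. simpl in HI'.
unfold B. rewrite (Bw_eq _ _ _ HI).
set (F := fun xi => HCscale (Cexp (Cmul Ci (RtoC (xi * t)))) (HCpowq (Xi xi) a v1 v2 v3)).
assert (J0 : Cint (fun xi => h0 (F xi)) = RtoC (Re I)).
{ apply Cint_has_int.
  replace (RtoC (Re I)) with (Cmul (RtoC (/ 2)) (Cadd I (Cconj I)))
    by (apply Cx_eq; simpl; field).
  apply (Chas_int_ae (fun x => Cmul (RtoC (/ 2))
    (Cadd (Bw_integrand (mkC a s) t x) (Bw_integrand (mkC a (- s)) t x)))).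
  - intros x Hx. unfold F. rewrite HCpowq_Xi by exact Hx. fold s. cbv zeta.
    cbn [HCscale h0 h1 h2 h3]. unfold Bw_integrand. ring.
  - apply Chas_int_scal, Chas_int_plus; assumption. }
assert (J : forall v, Chas_int (fun x => Cmul (RtoC (v / s)) (Cmul (mkC 0 (- / 2))
    (Cadd (Bw_integrand (mkC a s) t x) (Cmul (RtoC (-1)) (Bw_integrand (mkC a (- s)) t x)))))
    (RtoC (v / s * Im I))).
{ intros v. replace (RtoC (v / s * Im I)) with (Cmul (RtoC (v / s)) (Cmul (mkC 0 (- / 2))
    (Cadd I (Cmul (RtoC (-1)) (Cconj I))))).
  - apply Chas_int_scal, Chas_int_scal, Chas_int_plus; [|apply Chas_int_scal]; assumption.
  - generalize (v / s). intros k. apply Cx_eq; simpl; field. }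
assert (N1 : forall y, Cmul (RtoC (-1)) y = Copp y) by (intros; apply Cx_eq; simpl; ring).
change (Bq a v1 v2 v3 t) with
  (let c := RtoC (/ (2 * PI)) in
   mkHC (Cmul c (Cint (fun xi => h0 (F xi)))) (Cmul c (Cint (fun xi => h1 (F xi))))
     (Cmul c (Cint (fun xi => h2 (F xi)))) (Cmul c (Cint (fun xi => h3 (F xi))))).
cbv zeta. rewrite J0.
assert (J1 : Cint (fun xi => h1 (F xi)) = RtoC (v1 / s * Im I)).
{ apply Cint_has_int. apply (fun E => Chas_int_ae _ _ _ E (J v1)). intros x Hx.
  unfold F. rewrite HCpowq_Xi by exact Hx. fold s. cbv zeta.
  cbn [HCscale h0 h1 h2 h3]. unfold Bw_integrand. rewrite N1. ring. }
assert (J2 : Cint (fun xi => h2 (F xi)) = RtoC (v2 / s * Im I)).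
{ apply Cint_has_int. apply (fun E => Chas_int_ae _ _ _ E (J v2)). intros x Hx.
  unfold F. rewrite HCpowq_Xi by exact Hx. fold s. cbv zeta.
  cbn [HCscale h0 h1 h2 h3]. unfold Bw_integrand. rewrite N1. ring. }
assert (J3 : Cint (fun xi => h3 (F xi)) = RtoC (v3 / s * Im I)).
{ apply Cint_has_int. apply (fun E => Chas_int_ae _ _ _ E (J v3)). intros x Hx.
  unfold F. rewrite HCpowq_Xi by exact Hx. fold s. cbv zeta.
  cbn [HCscale h0 h1 h2 h3]. unfold Bw_integrand. rewrite N1. ring. }
rewrite J1, J2, J3.
f_equal; apply Cx_eq; simpl; ring.
Qed.

(** * Two-sided series *)

Lemma sumZ_cv_unique (f : Z -> R) (L L' : R) : sumZ_cv f L -> sumZ_cv f L' -> L = L'.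
Proof. apply UL_sequence. Qed.

Lemma RsumZ_cv (f : Z -> R) (L : R) : sumZ_cv f L -> RsumZ f = L.
Proof.
intros H. apply (sumZ_cv_unique f); [|exact H].
unfold RsumZ. apply ClassicalEpsilon.epsilon_spec. exists L. exact H.
Qed.

Lemma sumZ_cv_ext (f g : Z -> R) (L : R) : (forall l, f l = g l) -> sumZ_cv f L -> sumZ_cv g L.
Proof.
intros E H eps He. destruct (H eps He) as [N HN]. exists N. intros n Hn.
rewrite <- (sum_eq (fun k => f (Z.of_nat k - Z.of_nat n)%Z)); [apply HN, Hn|].
intros; apply E.
Qed.

Lemma sumZ_cv_lin (c d : R) (f g : Z -> R) (L L' : R) : sumZ_cv f L -> sumZ_cv g L' ->
  sumZ_cv (fun l => c * f l + d * g l) (c * L + d * L').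
Proof.
intros H H'. unfold sumZ_cv.
assert (K : forall c, Un_cv (fun _ => c) c).
{ intros k eps He. exists O. intros n _. unfold Rdist. rewrite Rminus_diag, Rabs_R0. exact He. }
assert (U := CV_plus _ _ _ _ (CV_mult _ _ _ _ (K c) H) (CV_mult _ _ _ _ (K d) H')).
intros eps He. destruct (U eps He) as [N HN]. exists N. intros n Hn. specialize (HN n Hn).
rewrite sum_plus.
assert (T : forall e h, sum_f_R0 (fun k => e * h k) (2 * n) = e * sum_f_R0 h (2 * n)).
{ intros e h. rewrite scal_sum. apply sum_eq. intros; ring. }
rewrite (T c (fun k => f (Z.of_nat k - Z.of_nat n)%Z)), (T d (fun k => g (Z.of_nat k - Z.of_nat n)%Z)).
exact HN.
Qed.

(** The window -N..N is indexed from 0, so enlarging it shifts the whole index by one and adds a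
    term at each end. *)
Lemma sumZ_partial_S (f : Z -> R) (N : nat) :
  sum_f_R0 (fun k => f (Z.of_nat k - Z.of_nat (S N))%Z) (2 * S N) =
  sum_f_R0 (fun k => f (Z.of_nat k - Z.of_nat N)%Z) (2 * N)
  + (f (Z.of_nat (S N)) + f (- Z.of_nat (S N))%Z).
Proof.
replace (2 * S N)%nat with (S (S (2 * N))) by lia.
rewrite tech5, decomp_sum by lia. rewrite Nat.pred_succ.
replace (f (Z.of_nat 0 - Z.of_nat (S N))%Z) with (f (- Z.of_nat (S N))%Z) by (f_equal; lia).
replace (f (Z.of_nat (S (S (2 * N))) - Z.of_nat (S N))%Z) with (f (Z.of_nat (S N)))
  by (f_equal; lia).
rewrite (sum_eq (fun k => f (Z.of_nat (S k) - Z.of_nat (S N))%Z)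
  (fun k => f (Z.of_nat k - Z.of_nat N)%Z)).
- ring.
- intros k _. f_equal. lia.
Qed.

(** Comparison with a telescoping series: by the mean value theorem tail n - tail (n+1) = (1 +
    c)^(-b) for some c in [n, n+1], which is at least (n+2)^(-b). The first term of the series is
    therefore split off. *)
Lemma ex_series_Rpower (b : R) : 1 < b -> ex_series (fun n => Rpower (INR (S n)) (- b)).
Proof.
intros b1.
assert (T : ex_series (fun n => tail b (INR n) - tail b (INR (S n)))).
{ exists (tail b 0).
  apply is_lim_seq_Reals. intros eps He. destruct (tail_small b eps b1 He) as [M [M0 HM]].
  destruct (nfloor_ex M M0) as [m [_ Hm]]. exists m. intros n Hn.
  assert (E : sum_n (fun n => tail b (INR n) - tail b (INR (S n))) n
    = tail b 0 - tail b (INR (S n))).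
  { clear. induction n as [|n IH].
    - rewrite sum_O. reflexivity.
    - rewrite sum_Sn, IH. unfold plus; simpl. ring. }
  apply (Rle_lt_trans _ _ _ (Req_le _ _ (f_equal (fun y => Rdist y (tail b 0)) E))).
  unfold Rdist.
  replace (tail b 0 - tail b (INR (S n)) - tail b 0) with (- tail b (INR (S n))) by ring.
  rewrite Rabs_Ropp, Rabs_pos_eq by (left; apply tail_pos, b1).
  apply HM. rewrite S_INR. apply le_INR in Hn. lra. }
apply ex_series_incr_1. revert T. apply (ex_series_le (K := R_AbsRing) (V := R_CompleteNormedModule)).
intros n. change (norm (Rpower (INR (S (S n))) (- b))) with (Rabs (Rpower (INR (S (S n))) (- b))).
rewrite Rabs_pos_eq by (left; apply exp_pos).
destruct (MVT_gen (tail b) (INR n) (INR (S n)) (fun x => - Rpower (1 + x) (- b))) as [c [Hc E]].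
- rewrite S_INR, Rmin_left by lra. intros x Hx. apply is_derive_tail; [exact b1|].
  pose proof (pos_INR n). lra.
- rewrite S_INR, Rmin_left by lra. intros x Hx. apply continuity_pt_filterlim.
  apply (ex_derive_continuous (tail b)). eexists. apply is_derive_tail; [exact b1|].
  pose proof (pos_INR n). lra.
- rewrite S_INR in E, Hc. rewrite Rmin_left, Rmax_right in Hc by lra.
  rewrite !S_INR. pose proof (pos_INR n).
  assert (Rpower (INR n + 1 + 1) (- b) <= Rpower (1 + c) (- b)).
  { unfold Rpower. apply exp_le.
    assert (ln (1 + c) <= ln (INR n + 1 + 1)) by (apply ln_le; lra). nra. }
  replace (tail b (INR n) - tail b (INR n + 1)) with (Rpower (1 + c) (- b)) by lra. exact H0.
Qed.

(** Pairing l with - l makes the symmetric partial sums those of an ordinary series, dominated by 2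
    C (n+1)^(-b). *)
Lemma sumZ_cv_exists (b C : R) (f : Z -> R) : 1 < b ->
  (forall l, 1 <= Rabs (IZR l) -> Rabs (f l) <= C * Rpower (Rabs (IZR l)) (- b)) ->
  exists L, sumZ_cv f L.
Proof.
intros b1 Hf.
assert (S1 : ex_series (fun n => f (Z.of_nat (S n)) + f (- Z.of_nat (S n))%Z)).
{ apply (ex_series_le (K := R_AbsRing) (V := R_CompleteNormedModule) _
    (fun n => 2 * C * Rpower (INR (S n)) (- b))).
  - intros n. eapply Rle_trans; [apply (Rabs_triang (f (Z.of_nat (S n))))|].
    assert (P : 1 <= INR (S n)) by (rewrite S_INR; pose proof (pos_INR n); lra).
    assert (H1 := Hf (Z.of_nat (S n))). assert (H2 := Hf (- Z.of_nat (S n))%Z).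
    rewrite opp_IZR, Rabs_Ropp in H2. rewrite <- INR_IZR_INZ, Rabs_pos_eq in H1, H2 by lra.
    specialize (H1 P). specialize (H2 P). lra.
  - apply (ex_series_scal_l (2 * C) (fun n => Rpower (INR (S n)) (- b))), ex_series_Rpower, b1. }
destruct S1 as [L HL]. exists (f 0%Z + L).
apply is_lim_seq_Reals in HL. intros eps He. destruct (HL eps He) as [N HN].
exists (S N). intros n Hn. destruct n as [|n]; [lia|].
assert (E : sum_f_R0 (fun k => f (Z.of_nat k - Z.of_nat (S n))%Z) (2 * S n)
  = f 0%Z + sum_n (fun n => f (Z.of_nat (S n)) + f (- Z.of_nat (S n))%Z) n).
{ clear. induction n as [|n IH].
  - rewrite sumZ_partial_S, sum_O. reflexivity.
  - rewrite sumZ_partial_S, IH, sum_Sn. unfold plus; simpl. ring. }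
rewrite E. specialize (HN n ltac:(lia)). unfold Rdist in *.
replace (f 0%Z + sum_n (fun n => f (Z.of_nat (S n)) + f (- Z.of_nat (S n))%Z) n - (f 0%Z + L))
  with (sum_n (fun n => f (Z.of_nat (S n)) + f (- Z.of_nat (S n))%Z) n - L) by ring.
exact HN.
Qed.

Lemma Cnorm2_mul (x y : Cx) : Cnorm2 (Cmul x y) = Cnorm2 x * Cnorm2 y.
Proof. unfold Cnorm2; simpl; ring. Qed.

Lemma Cnorm2_Cpowz (z : Cx) (l : Z) : Cnorm2 z = 1 -> Cnorm2 (Cpowz z l) = 1.
Proof.
intros Hz.
assert (H : forall n, Cnorm2 (Cpown z n) = 1).
{ induction n as [|n IH]; simpl; [unfold Cnorm2; simpl; ring|].
  rewrite Cnorm2_mul, Hz, IH. ring. }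
destruct l; simpl; [unfold Cnorm2; simpl; ring|apply H|].
specialize (H (Pos.to_nat p)). unfold Cinv. rewrite H. unfold Cnorm2 in *. simpl.
transitivity (Re (Cpown z (Pos.to_nat p)) * Re (Cpown z (Pos.to_nat p))
  + Im (Cpown z (Pos.to_nat p)) * Im (Cpown z (Pos.to_nat p))); [field|exact H].
Qed.

Definition CsumZ_cv (f : Z -> Cx) (L : Cx) : Prop :=
  sumZ_cv (fun l => Re (f l)) (Re L) /\ sumZ_cv (fun l => Im (f l)) (Im L).

Lemma CsumZ_eq (f : Z -> Cx) (L : Cx) : CsumZ_cv f L -> CsumZ f = L.
Proof. intros [H1 H2]. apply Cx_eq; simpl; apply RsumZ_cv; assumption. Qed.

(** Every sum in the theorem is a combination of the two series with real coefficients Re B_w(l) and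
    Im B_w(l), so convergence of these two is enough. *)
Lemma CsumZ_lin (c d : Cx) (f g h : Z -> Cx) (L L' : Cx) : CsumZ_cv f L -> CsumZ_cv g L' ->
  (forall l, h l = Cadd (Cmul c (f l)) (Cmul d (g l))) ->
  CsumZ h = Cadd (Cmul c L) (Cmul d L').
Proof.
intros [H1 H2] [H3 H4] E. apply CsumZ_eq. split.
- assert (A := sumZ_cv_lin (Re c) (- Im c) _ _ _ _ H1 H2).
  assert (B := sumZ_cv_lin (Re d) (- Im d) _ _ _ _ H3 H4).
  assert (Q := sumZ_cv_lin 1 1 _ _ _ _ A B).
  match type of Q with sumZ_cv _ ?x => replace (Re (Cadd (Cmul c L) (Cmul d L'))) with x
    by (simpl; ring) end.
  revert Q. apply sumZ_cv_ext. intros l. rewrite E. simpl. ring.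
- assert (A := sumZ_cv_lin (Re c) (Im c) _ _ _ _ H2 H1).
  assert (B := sumZ_cv_lin (Re d) (Im d) _ _ _ _ H4 H3).
  assert (Q := sumZ_cv_lin 1 1 _ _ _ _ A B).
  match type of Q with sumZ_cv _ ?x => replace (Im (Cadd (Cmul c L) (Cmul d L'))) with x
    by (simpl; ring) end.
  revert Q. apply sumZ_cv_ext. intros l. rewrite E. simpl. ring.
Qed.

Lemma CsumZ_cv_exists (b C : R) (z : Cx) (f : Z -> R) : 1 < b -> Cnorm2 z = 1 ->
  (forall l, 1 <= Rabs (IZR l) -> Rabs (f l) <= C * Rpower (Rabs (IZR l)) (- b)) ->
  exists L, CsumZ_cv (fun l => Cmul (Cpowz z l) (RtoC (f l))) L.
Proof.
intros b1 Hz Hf.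
assert (Hr : forall l, Rabs (Re (Cpowz z l)) <= 1 /\ Rabs (Im (Cpowz z l)) <= 1).
{ intros l. assert (N := Cnorm2_Cpowz z l Hz). unfold Cnorm2 in N.
  split; apply Rabs_le; nra. }
assert (Hb : forall r : Z -> R, (forall l, Rabs (r l) <= 1) -> forall l, 1 <= Rabs (IZR l) ->
  Rabs (r l * f l) <= C * Rpower (Rabs (IZR l)) (- b)).
{ intros r H l Hl. rewrite Rabs_mult. specialize (H l). specialize (Hf l Hl).
  pose proof (Rabs_pos (f l)). pose proof (Rabs_pos (r l)). nra. }
destruct (sumZ_cv_exists b C (fun l => Re (Cpowz z l) * f l) b1) as [L1 H1].
{ apply (Hb (fun l => Re (Cpowz z l))). intros l; apply Hr. }
destruct (sumZ_cv_exists b C (fun l => Im (Cpowz z l) * f l) b1) as [L2 H2].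
{ apply (Hb (fun l => Im (Cpowz z l))). intros l; apply Hr. }
exists (mkC L1 L2). split; [revert H1|revert H2]; apply sumZ_cv_ext; intros l; simpl; ring.
Qed.

(** * Algebra of complex quaternions *)

Lemma HCmul_assoc (x y u : HC) : HCmul x (HCmul y u) = HCmul (HCmul x y) u.
Proof. unfold HCmul; cbn [h0 h1 h2 h3]. f_equal; ring. Qed.

Lemma HCmul_1_r (x : HC) : HCmul x HC1 = x.
Proof. destruct x as [x0 x1 x2 x3]. unfold HCmul, HC1; cbn [h0 h1 h2 h3]. f_equal; ring. Qed.

Lemma HCmul_scale_r (c : Cx) (x y : HC) : HCmul x (HCscale c y) = HCscale c (HCmul x y).
Proof. unfold HCmul, HCscale; cbn [h0 h1 h2 h3]. f_equal; ring. Qed.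

Lemma HCmul_scale_l (c : Cx) (x y : HC) : HCmul (HCscale c x) y = HCscale c (HCmul x y).
Proof. unfold HCmul, HCscale; cbn [h0 h1 h2 h3]. f_equal; ring. Qed.

Lemma Cinv_l (x : Cx) : x <> C0 -> Cmul (Cinv x) x = C1.
Proof.
intros H. assert (Cnorm2 x <> 0).
{ intros E. apply H. unfold Cnorm2 in E. apply Cx_eq; simpl; nra. }
unfold Cinv. apply Cx_eq; simpl.
- transitivity ((Re x * Re x + Im x * Im x) / Cnorm2 x); [field; assumption|].
  change (Re x * Re x + Im x * Im x) with (Cnorm2 x). field; assumption.
- field; assumption.
Qed.

(** The hypothesis says that k = k1 e1 + k2 e2 + k3 e3 satisfies k^2 = -1. Since k commutes with
    complex scalars, (p + k q)(p - k q) = p^2 - k^2 q^2. *)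
Lemma HCmul_conj (p q k1 k2 k3 : Cx) :
  Cadd (Cadd (Cmul k1 k1) (Cmul k2 k2)) (Cmul k3 k3) = C1 ->
  HCmul (mkHC p (Cmul k1 q) (Cmul k2 q) (Cmul k3 q))
    (mkHC p (Cmul (Copp k1) q) (Cmul (Copp k2) q) (Cmul (Copp k3) q))
  = HCscale (Cadd (Cmul p p) (Cmul q q)) HC1.
Proof.
intros E. unfold HCmul, HCscale, HC1; cbn [h0 h1 h2 h3]. f_equal; try ring.
transitivity (Cadd (Cmul p p) (Cmul (Cadd (Cadd (Cmul k1 k1) (Cmul k2 k2)) (Cmul k3 k3)) (Cmul q q)));
  [ring|rewrite E; ring].
Qed.

Theorem theorem2 (a v1 v2 v3 : R) (z : Cx) :
  1 < a -> ~ (v1 = 0 /\ v2 = 0 /\ v3 = 0) -> Cabs z = 1 ->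
  let s := vnorm v1 v2 v3 in
  let w := mkC a s in
  let Sq := HCsumZ (fun l => HCscale (Cpowz z l) (Bq a v1 v2 v3 (IZR l))) in
  let Sw := CsumZ (fun l => Cmul (Bw w (IZR l)) (Cpowz z l)) in
  let Swb := CsumZ (fun k => Cmul (Bw (Cconj w) (IZR k)) (Cpowz z k)) in
  let Num := HCsumZ (fun l =>
       HCscale (Cpowz z l)
         (mkHC (RtoC (Re (Bw w (IZR l))))
               (RtoC (- (v1 / s) * Im (Bw w (IZR l))))
               (RtoC (- (v2 / s) * Im (Bw w (IZR l))))
               (RtoC (- (v3 / s) * Im (Bw w (IZR l)))))) in
  let Inv := HCscale (Cinv (Cmul Sw Swb)) Num in
  (HCinvertible Sq <-> Cmul Sw Swb <> C0) /\
  (Cmul Sw Swb <> C0 -> HCmul Sq Inv = HC1 /\ HCmul Inv Sq = HC1).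
Proof.
intros a1 v0 Hz s w Sq Sw Swb Num Inv.
assert (s2 : s * s = v1 * v1 + v2 * v2 + v3 * v3) by (apply sqrt_sqrt; nra).
assert (s0 : s <> 0).
{ intros E. apply v0. rewrite E in s2. repeat split; nra. }
assert (Hz2 : Cnorm2 z = 1).
{ unfold Cabs in Hz. rewrite <- (sqrt_sqrt (Cnorm2 z)) by (unfold Cnorm2; nra). rewrite Hz. ring. }
assert (b1 : 1 < Rmin a 2) by (apply Rmin_glb_lt; lra).
destruct (Bw_integral a s a1) as [C [_ HB]].
assert (c0 : 0 < / (2 * PI)) by (apply Rinv_0_lt_compat; pose proof PI_RGT_0; lra).
assert (Hdecay : forall t, 1 <= Rabs t ->
  Rabs (Re (Bw w t)) <= / (2 * PI) * C * Rpower (Rabs t) (- Rmin a 2) /\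
  Rabs (Im (Bw w t)) <= / (2 * PI) * C * Rpower (Rabs t) (- Rmin a 2)).
{ intros t Ht. destruct (HB t) as [I [HI HD]]. destruct (HD Ht) as [D1 D2].
  unfold w. rewrite (Bw_eq _ _ _ HI). simpl.
  rewrite !Rmult_0_l, Rminus_0_r, Rplus_0_r, !Rabs_mult, (Rabs_pos_eq (/ (2 * PI))), !Rmult_assoc by lra.
  split; apply Rmult_le_compat_l; lra. }
destruct (CsumZ_cv_exists _ _ z (fun l => Re (Bw w (IZR l))) b1 Hz2
  (fun l Hl => proj1 (Hdecay _ Hl))) as [P HP].
destruct (CsumZ_cv_exists _ _ z (fun l => Im (Bw w (IZR l))) b1 Hz2
  (fun l Hl => proj2 (Hdecay _ Hl))) as [Q HQ].
assert (ESw : Sw = Cadd (Cmul C1 P) (Cmul Ci Q)).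
{ apply (CsumZ_lin _ _ _ _ _ _ _ HP HQ). intros l. apply Cx_eq; simpl; ring. }
assert (ESwb : Swb = Cadd (Cmul C1 P) (Cmul (Copp Ci) Q)).
{ apply (CsumZ_lin _ _ _ _ _ _ _ HP HQ). intros l. rewrite Bw_conj by exact a1.
  apply Cx_eq; simpl; ring. }
assert (EM : Cmul Sw Swb = Cadd (Cmul P P) (Cmul Q Q)).
{ rewrite ESw, ESwb. apply Cx_eq; simpl; ring. }
assert (Lin0 : CsumZ (fun l => Cmul (Cpowz z l) (RtoC (Re (Bw w (IZR l))))) = P)
  by (apply CsumZ_eq, HP).
assert (Lin : forall k, CsumZ (fun l => Cmul (Cpowz z l) (RtoC (k * Im (Bw w (IZR l)))))
  = Cmul (RtoC k) Q).
{ intros k. transitivity (Cadd (Cmul C0 P) (Cmul (RtoC k) Q)); [|ring].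
  apply (CsumZ_lin _ _ _ _ _ _ _ HP HQ). intros l. apply Cx_eq; simpl; ring. }
set (k1 := RtoC (v1 / s)). set (k2 := RtoC (v2 / s)). set (k3 := RtoC (v3 / s)).
assert (ESq : Sq = mkHC P (Cmul k1 Q) (Cmul k2 Q) (Cmul k3 Q)).
{ unfold Sq. transitivity (HCsumZ (fun l => HCscale (Cpowz z l)
    (mkHC (RtoC (Re (Bw w (IZR l)))) (RtoC (v1 / s * Im (Bw w (IZR l))))
      (RtoC (v2 / s * Im (Bw w (IZR l)))) (RtoC (v3 / s * Im (Bw w (IZR l))))))).
  - f_equal. apply FunctionalExtensionality.functional_extensionality. intros l.
    rewrite Bq_Bw by exact a1. reflexivity.
  - unfold HCsumZ. cbn [HCscale h0 h1 h2 h3]. rewrite Lin0, !Lin. reflexivity. }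
assert (RtoC_opp : forall r, RtoC (- r) = Copp (RtoC r)) by (intros; apply Cx_eq; simpl; ring).
assert (ENum : Num = mkHC P (Cmul (Copp k1) Q) (Cmul (Copp k2) Q) (Cmul (Copp k3) Q)).
{ unfold Num, HCsumZ. cbn [HCscale h0 h1 h2 h3]. rewrite Lin0, !Lin, !RtoC_opp. reflexivity. }
assert (K : Cadd (Cadd (Cmul k1 k1) (Cmul k2 k2)) (Cmul k3 k3) = C1).
{ apply Cx_eq; simpl; [|ring].
  transitivity ((v1 * v1 + v2 * v2 + v3 * v3) / (s * s)); [field; exact s0|].
  rewrite <- s2. field. exact s0. }
assert (Kopp : Cadd (Cadd (Cmul (Copp k1) (Copp k1)) (Cmul (Copp k2) (Copp k2)))
  (Cmul (Copp k3) (Copp k3)) = C1) by (rewrite <- K; ring).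
assert (M1 : HCmul Sq Num = HCscale (Cmul Sw Swb) HC1).
{ rewrite EM, ESq, ENum. apply HCmul_conj, K. }
assert (M2 : HCmul Num Sq = HCscale (Cmul Sw Swb) HC1).
(* The reversed product is [HCmul_conj] for - k in place of k. *)
{ rewrite EM, ESq, ENum, <- (HCmul_conj _ _ _ _ _ Kopp). do 2 f_equal; ring. }
assert (Main : Cmul Sw Swb <> C0 -> HCmul Sq Inv = HC1 /\ HCmul Inv Sq = HC1).
{ intros N. unfold Inv. rewrite HCmul_scale_r, HCmul_scale_l, M1, M2.
  assert (E : HCscale (Cinv (Cmul Sw Swb)) (HCscale (Cmul Sw Swb) HC1) = HC1).
  { apply Cinv_l in N. unfold HCscale, HC1; cbn [h0 h1 h2 h3].
    f_equal; [|ring..].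
    transitivity (Cmul (Cinv (Cmul Sw Swb)) (Cmul Sw Swb)); [ring|exact N]. }
  split; exact E. }
split; [|exact Main]. split.
(* Complex quaternions have zero divisors, so a vanishing product Num Sq alone decides nothing. But
   if Sq r = 1, then Num = (Num Sq) r = 0. As Num differs from Sq only in the sign of its vector
   part, Sq = 0 follows, against Sq r = 1. *)
- intros [r [Hr _]] E0.
  assert (EN : Num = HCscale C0 r).
  { rewrite <- (HCmul_1_r Num), <- Hr, HCmul_assoc, M2, E0, HCmul_scale_l.
    unfold HCmul, HCscale, HC1; cbn [h0 h1 h2 h3]. f_equal; ring. }
  rewrite ENum in EN.
  assert (N0 : P = C0) by (rewrite (f_equal h0 EN : P = Cmul C0 (h0 r)); ring).
  assert (N1 := f_equal h1 EN). assert (N2 := f_equal h2 EN). assert (N3 := f_equal h3 EN).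
  cbn [HCscale h1 h2 h3] in N1, N2, N3.
  assert (T : forall k y, Cmul (Copp k) Q = Cmul C0 y -> Cmul k Q = C0).
  { intros k y Ek. transitivity (Copp (Cmul (Copp k) Q)); [ring|rewrite Ek; ring]. }
  apply T in N1, N2, N3. rewrite ESq, N0, N1, N2, N3 in Hr.
  apply (f_equal h0), (f_equal Re) in Hr. simpl in Hr. lra.
- intros N. exists Inv. apply Main, N.
Qed.
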